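(* Let $p$ be a prime and let $K$ be a finitely generated field extension of $\mathbb{F}_p$. Let $E \subseteq K^n \times K^m$ be the zero set (in $K^{n+m}$) of a set of polynomials in $K[x_1,\ldots,x_{n+m}]$. Let $d,s \in \mathbb{N}$ and suppose $E$ is $K_{d,s}$-free, i.e.\ whenever $A\times B \subseteq E$ we have $|A| < d$ or $|B| < s$. Then there exist $\epsilon > 0$ and $C > 0$ such that for all finite subsets $A \subseteq K^n$ and $B \subseteq K^m$, $$|E \cap (A \times B)| \leq C\left(|A|^{1-\epsilon}|B|^{\frac{d-1}{d}(1+\epsilon)} + |A| + |B|\right).$$ *)

(* Defs.v *)
From HB Require Import structures.
From mathcomp Require Import all_boot all_order all_algebra.
From mathcomp Require Import finmap mpoly.
From Stdlib Require Import Reals ClassicalEpsilon.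

Set Implicit Arguments.
Unset Strict Implicit.
Unset Printing Implicit Defensive.

Import GRing.Theory.
Local Open Scope ring_scope.


Definition is_subfield (K : fieldType) (S : K -> Prop) : Prop :=
  S 0 /\ S 1 /\
  (forall x y, S x -> S y -> S (x + y)) /\
  (forall x, S x -> S (- x)) /\
  (forall x y, S x -> S y -> S (x * y)) /\
  (forall x, S x -> S x^-1).

Definition finitely_generated_field (K : fieldType) : Prop :=
  exists s : seq K, forall S : K -> Prop, is_subfield S ->
    (forall x, x \in s -> S x) -> forall x, S x.

Definition fg_ext_of_Fp (p : nat) (K : fieldType) : Prop :=
  p \in [pchar K] /\ finitely_generated_field K.

Definition zero_set (K : fieldType) (n m : nat)
  (P : {mpoly K[n + m]} -> Prop) (x : 'rV[K]_n) (y : 'rV[K]_m) : Prop :=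
  forall q, P q -> q.@[fun i => row_mx x y 0 i] = 0.

Definition Kds_free (K : fieldType) (n m : nat)
  (E : 'rV[K]_n -> 'rV[K]_m -> Prop) (d s : nat) : Prop :=
  forall (A : {fset 'rV[K]_n}) (B : {fset 'rV[K]_m}),
    (forall a b, a \in A -> b \in B -> E a b) ->
    ltn #|` A|%fset d \/ ltn #|` B|%fset s.

Definition pbool (P : Prop) : bool :=
  if excluded_middle_informative P then true else false.

Definition incidences (K : fieldType) (n m : nat)
  (E : 'rV[K]_n -> 'rV[K]_m -> Prop)
  (A : {fset 'rV[K]_n}) (B : {fset 'rV[K]_m}) : nat :=
  #|` [fset ab in (A `*` B)%fset | pbool (E ab.1 ab.2)]|%fset.

Definition npow (a : nat) (x : R) : R :=
  if a == 0%nat then 0%R else Rpower (INR a) x.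

(* Main.v *)
Require Import Defs.
From Stdlib Require Import ZArith Reals Lra ClassicalEpsilon Classical.
From HB Require Import structures.
From mathcomp Require Import all_boot all_order all_algebra.
From mathcomp Require Import finmap mpoly finfield.
From mathcomp Require Import zify ring.

(* The set K^n is cut into few cells, each crossed by a small proportion of the
   fibres of E over B, and the Kővári–Sós–Turán count is applied in every cell;
   optimizing the number of cells gains a power of |A|.

   By the Hilbert basis theorem and linearization, cuttings for E reduce to
   cuttings for the incidence x.y = 0 over K. These exist over finite fields and
   pass from a field k to k[t]: choose a k[t]-lattice that is semistable for the
   given functionals, so that every primitive vector stays, modulo t, outside
   the kernels of a positive proportion of the reduced functionals, and cut the
   reductions modulo t by means of k. They also pass to fraction fields and to
   finite extensions, hence to all finitely generated extensions of F_p. *)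

Set Implicit Arguments.
Unset Strict Implicit.
Unset Printing Implicit Defensive.

(** What must be found is one number of cells [T], the same for every [B], with any proportion below
    1: cutting the cells again and again makes the proportion decay like a power of the number of
    cells, and this rate becomes [eps]. For d >= 2 and delta = (d-1)/d, [T] cells at proportion 1/2
    give eps = delta ln 2 / (ln T + delta ln 2). Over k[t] the obstacle is that incidence implies
    incidence modulo [t] but not conversely, so cells defined by residues control a functional only
    where its non-incidence shows modulo [t]. Semistability supplies this: at every nonzero vector,
    made primitive in the lattice, a fixed share of the functionals is nonzero modulo [t]. No
    lattice can do this if too many functionals vanish at one common vector; in that case the vector
    is divided out and the dimension drops. *)

Lemma pboolP (P : Prop) : reflect P (pbool P).
Proof. by rewrite /pbool; case: excluded_middle_informative => ?; constructor. Qed.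

Lemma choice_fun (A B : Type) (Q : A -> B -> Prop) :
  (forall a, exists b, Q a b) -> exists f : A -> B, forall a, Q a (f a).
Proof.
move=> h; exists (fun a => proj1_sig (constructive_indefinite_description _ (h a))).
by move=> a; case: constructive_indefinite_description.
Qed.

(** * Cuttings and their amplification *)

Section Cuttings.

Definition crossing (X Y : Type) (I : X -> Y -> Prop) (c : X -> nat)
    (i : nat) (y : Y) : Prop :=
  exists x x', [/\ c x = i, c x' = i, I x y & ~ I x' y].

Definition crossings (X Y : Type) (I : X -> Y -> Prop) (c : X -> nat)
    (i : nat) (B : seq Y) : nat :=
  count (fun y => pbool (crossing I c i y)) B.

(** The proportion [a / r] is kept as a pair of naturals, and [T] is fixed before [B]. Ranges form a
    list, since distinct ranges may become equal under a reduction and must still be counted with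
    multiplicity. *)
Definition cutting (X Y : Type) (I : X -> Y -> Prop) (T a r : nat) : Prop :=
  forall B : seq Y, exists c : X -> nat,
    (forall x, c x < T) /\ forall i, r * crossings I c i B <= a * size B.

Definition cuttable (X Y : Type) (I : X -> Y -> Prop) : Prop :=
  forall r, exists T, cutting I T 1 r.

Lemma crossings_eq0 (X Y : Type) (I : X -> Y -> Prop) c i B :
  (forall y, ~ crossing I c i y) -> crossings I c i B = 0.
Proof.
move=> h; apply/eqP; rewrite -leqn0 leqNgt -has_count.
by elim: B => //= y B; case: pboolP => // /h.
Qed.

(* The cells of the second cutting are chosen inside each cell of the first,
   for the ranges that cross it. *)
Lemma cutting_mul (X Y : Type) (I : X -> Y -> Prop) T a r T' a' r' :
  cutting I T a r -> cutting I T' a' r' ->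
  cutting I (T * T') (a * a') (r * r').
Proof.
move=> h h' B; have [c [cT hc]] := h B.
have [c' hc'] := choice_fun (fun i =>
  h' [seq y <- B | pbool (crossing I c i y)]).
have T'gt0 (x : X) : 0 < T' by case: (hc' 0) => /(_ x); lia.
exists (fun x => c x * T' + c' (c x) x); split.
  move=> x; have [/(_ x) lt1 _] := hc' (c x).
  by have := cT x; nia.
move=> j.
have [x0|nox] := excluded_middle_informative
   (exists x, c x * T' + c' (c x) x = j); last first.
  suff -> : crossings I (fun x => c x * T' + c' (c x) x) j B = 0 by rewrite muln0.
  by apply: crossings_eq0 => y [x [_ [e _ _ _]]]; case: nox; exists x.
have [x ex] := x0.
have uniqc x' : c x' * T' + c' (c x') x' = j -> c x' = c x /\ c' (c x) x' = c' (c x) x.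
  have [/(_ x) l1 _] := hc' (c x); have [/(_ x') l2 _] := hc' (c x').
  move=> e; have e1 : c x' = c x.
    by have := congr1 (fun z => z %/ T') (etrans e (esym ex));
       rewrite !divnMDl ?(T'gt0 x) // !divn_small ?addn0.
  split=> //; move: e; rewrite -ex e1; lia.
have [_ /(_ (c' (c x) x)) hcr] := hc' (c x).
have := hc (c x); rewrite {1}/crossings -size_filter => hcx.
suff le : crossings I (fun x => c x * T' + c' (c x) x) j B <=
   crossings I (c' (c x)) (c' (c x) x) [seq y <- B | pbool (crossing I c (c x) y)].
  rewrite -!mulnA [r * _]mulnCA [a * _]mulnCA.
  apply: leq_trans (_ : r * (a' * size [seq y <- B | pbool (crossing I c (c x) y)]) <= _).
    by rewrite mulnCA leq_mul2l (leq_trans _ hcr) ?orbT // leq_mul2l le orbT.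
  by rewrite mulnCA leq_mul2l hcx orbT.
rewrite /crossings count_filter; apply: sub_count => y /pboolP [u [v [/uniqc[u1 u2] /uniqc[v1 v2] iu iv]]] /=.
by apply/andP; split; apply/pboolP; exists u, v.
Qed.

Lemma cutting_exp (X Y : Type) (I : X -> Y -> Prop) T a r j :
  cutting I T a r -> cutting I (T ^ j) (a ^ j) (r ^ j).
Proof.
move=> h; elim: j => [|j IH]; last by rewrite !expnS; apply: cutting_mul.
by move=> B; exists (fun=> 0); split=> // i; rewrite !expn0 !mul1n count_size.
Qed.

Lemma ltn_expn_unbounded a r n : 0 < a -> a < r -> exists j, n * a ^ j <= r ^ j.
Proof.
move=> a0 ar; exists (a * n).
(* Bernoulli's inequality for (1 + 1/a)^j, multiplied by a^(j+1). *)
suff h j : (a + j) * a ^ j <= a * r ^ j.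
  rewrite -(leq_pmul2l a0) mulnA; apply: leq_trans (h (a * n)).
  by rewrite leq_mul2r leq_addl orbT.
elim: j => [|j IH]; first by rewrite addn0 !expn0.
rewrite !expnS; apply: leq_trans (_ : a * r ^ j * a.+1 <= _); last first.
  by rewrite -mulnA [r ^ j * _]mulnC leq_mul2l leq_mul2r ar !orbT.
by apply: leq_trans (leq_mul IH (leqnn _)); move: (a ^ j) => z; nia.
Qed.

(** Nesting the cutting [j] times turns the proportion into (a/r)^j, which tends to 0. *)
Lemma cuttable_of_cutting (X Y : Type) (I : X -> Y -> Prop) T a r :
  a < r -> cutting I T a r -> cuttable I.
Proof.
move=> ar h n; case: (posnP a) => [a0|a0].
  exists T => B; have [c [cT hc]] := h B; exists c; split=> // i.
  by have := hc i; rewrite a0 mul0n leqn0 muln_eq0 (gtn_eqF (leq_ltn_trans (leq0n _) ar)) /= => /eqP ->; rewrite muln0.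
have [j hj] := ltn_expn_unbounded n a0 ar.
exists (T ^ j) => B; have [c [cT hc]] := cutting_exp j h B.
exists c; split=> // i; rewrite mul1n -(@leq_pmul2l (a ^ j)) ?expn_gt0 ?a0 //.
apply: leq_trans (hc i); rewrite mulnA leq_mul2r.
by rewrite mulnC hj orbT.
Qed.

Lemma cuttable_pull (X Y X' Y' : Type) (I : X -> Y -> Prop)
    (I' : X' -> Y' -> Prop) :
  (exists (f : X' -> X) (g : Y' -> Y), forall x y, I' x y <-> I (f x) (g y)) ->
  cuttable I -> cuttable I'.
Proof.
move=> [f [g fg]] h r; have [T hT] := h r; exists T => B.
have [c [cT hc]] := hT (map g B); exists (c \o f); split=> [x|i]; first exact: cT.
have := hc i; rewrite size_map; apply: leq_trans; rewrite leq_mul2l.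
apply/orP; right; rewrite /crossings count_map; apply: sub_count => y /pboolP [x [x' [e e' /fg ? nI]]].
by apply/pboolP; exists (f x), (f x'); split=> // /fg.
Qed.

Lemma cuttable_true (X Y : Type) (I : X -> Y -> Prop) :
  (forall x y, I x y) -> cuttable I.
Proof.
move=> h r; exists 1 => B; exists (fun=> 0); split=> // i.
by rewrite crossings_eq0 ?muln0 // => y [x [x' [_ _ _]]].
Qed.

(** On the common refinement, a range crossing a cell for the conjunction crosses it for one of the
    two relations; hence the proportion 1/(2r) asked of each. *)
Lemma cuttable_and (X Y : Type) (I I1 I2 : X -> Y -> Prop) :
  (forall x y, I x y <-> I1 x y /\ I2 x y) ->
  cuttable I1 -> cuttable I2 -> cuttable I.
Proof.
move=> hI h1 h2 r; have [T1 hT1] := h1 (2 * r); have [T2 hT2] := h2 (2 * r).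
exists (T1 * T2) => B; have [c1 [cT1 hc1]] := hT1 B; have [c2 [cT2 hc2]] := hT2 B.
exists (fun x => c1 x * T2 + c2 x); split=> [x|i].
  by have := cT1 x; have := cT2 x; nia.
have := hc1 (i %/ T2); have := hc2 (i %% T2).
rewrite !mul1n => le2 le1.
suff : crossings I (fun x => c1 x * T2 + c2 x) i B <=
   crossings I1 c1 (i %/ T2) B + crossings I2 c2 (i %% T2) B by nia.
rewrite -count_predUI; apply: leq_trans (leq_addr _ _).
apply: sub_count => y /pboolP [x [x' [e e' /hI [i1 i2] nI]]] /=.
have T2gt0 : 0 < T2 by have := cT2 x; lia.
have [ex ex'] : (c1 x = i %/ T2 /\ c2 x = i %% T2) /\ (c1 x' = i %/ T2 /\ c2 x' = i %% T2).
  by rewrite -{1 2}e -e' !divnMDl // !modnMDl !divn_small ?modn_small ?addn0.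
apply/orP; case: (excluded_middle_informative (I1 x' y)) => [i1'|ni1].
  by right; apply/pboolP; exists x, x'; split=> //; [tauto|tauto|move=> ?; apply/nI/hI].
by left; apply/pboolP; exists x, x'; split=> //; tauto.
Qed.

Lemma cuttable_all (X Y : Type) (J : eqType) (s : seq J) (I : J -> X -> Y -> Prop) :
  (forall j, cuttable (I j)) -> cuttable (fun x y => forall j, j \in s -> I j x y).
Proof.
move=> h; elim: s => [|j s IH]; first exact: cuttable_true.
apply: cuttable_and (h j) IH => x y; split=> [H|[h1 h2] j'].
  by split=> [|j' js]; apply: H; rewrite in_cons ?eqxx ?js ?orbT.
by rewrite in_cons => /predU1P [->|/h2].
Qed.

End Cuttings.

(** * Semistable lattices over a ring with a residue map *)

Section Lattices.

Import GRing.Theory.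
Local Open Scope ring_scope.

Variables (R : idomainType) (k : fieldType) (res : {rmorphism R -> k}).
Variables (t : R) (dv : R -> R).
Hypotheses (t_neq0 : t != 0) (res_t : res t = 0).
Hypothesis dvK : forall x, res x = 0 -> x = t * dv x.

(** Basis change to the lattice spanned by [x] and [t] times the standard basis. When [x i0 0] is
    nonzero modulo [t], the vector [t e_i0] is locally at [t] a combination of the columns, so [x]
    can take its place. *)
Definition pivot_mx (N : nat) (i0 : 'I_N) (x : 'cV[R]_N) : 'M[R]_N :=
  \matrix_(a, l) if l == i0 then x a 0 else t *+ (a == l).

Lemma det_pivot_mx (n : nat) (i0 : 'I_n.+1) (x : 'cV[R]_n.+1) :
  \det (pivot_mx i0 x) = x i0 0 * t ^+ n.
Proof.
rewrite (expand_det_row _ i0) (bigD1 i0) //= big1 ?addr0 => [|l li0]; last first.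
  by rewrite mxE (negPf li0) eq_sym (negPf li0) mul0r.
rewrite mxE eqxx /cofactor addnn -signr_odd odd_double mul1r.
congr (_ * _); rewrite -det_scalar; congr (\det _).
apply/matrixP => a l; rewrite !mxE (inj_eq lift_inj) eq_sym.
by rewrite (negPf (neq_lift i0 l)).
Qed.

Lemma mulmx_pivotE (N : nat) (i0 : 'I_N) (x : 'cV[R]_N) (U : 'M[R]_N) i l :
  (U *m pivot_mx i0 x) i l = if l == i0 then (U *m x) i 0 else t * U i l.
Proof.
rewrite mxE; case: eqP => [->|/eqP li0].
  by rewrite mxE; apply: eq_bigr => a _; rewrite mxE eqxx.
rewrite (bigD1 l) //= big1 ?addr0 => [|a al].
  by rewrite mxE (negPf li0) eqxx mulrC.
by rewrite mxE (negPf li0) (negPf al) mulr0.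
Qed.

Lemma det_scale_rows (N : nat) (e : 'I_N -> R) (U : 'M[R]_N) :
  \det (\matrix_(i, l) (e i * U i l)) = (\prod_i e i) * \det U.
Proof.
rewrite -[X in \det X](_ : diag_mx (\row_i e i) *m U = _).
  by rewrite det_mulmx det_diag; congr (_ * _); apply: eq_bigr => i _; rewrite mxE.
by apply/matrixP => i l; rewrite mul_diag_mx !mxE.
Qed.

Definition nonvanishing (M N : nat) (U : 'I_M -> 'M[R]_N) (x : 'cV[R]_N) :
    {set 'I_M * 'I_N} :=
  [set ji | res ((U ji.1 *m x) ji.2 0) != 0].

(* Semistability: as long as some primitive vector [x] is killed modulo [t] by
   too many rows, passing to the sublattice spanned by [x] and [t] times the
   standard basis lowers the total order of the determinants. *)
Lemma semistable_lattice (n M o : nat) (v : R) (U : 'I_M -> 'M[R]_n.+1) :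
  res v != 0 -> \prod_j \det (U j) = t ^+ o * v ->
  exists (g : 'M[R]_n.+1) (U' : 'I_M -> 'M[R]_n.+1) (e : 'I_M -> 'I_n.+1 -> nat),
    [/\ \det g != 0,
        forall j i l, (U j *m g) i l = t ^+ e j i * U' j i l &
        forall (x : 'cV[R]_n.+1) i0, res (x i0 0) != 0 ->
          (M <= #|nonvanishing U' x|)%N].
Proof.
elim/ltn_ind: o => o IH in v U *; move=> v0 Uo.
pose good (x : 'cV[R]_n.+1) :=
  (M <= #|nonvanishing U x|)%N.
have [h|] := excluded_middle_informative
   (forall (x : 'cV[R]_n.+1) i0, res (x i0 0) != 0 -> good x).
  exists 1%:M, U, (fun _ _ => 0%N); split=> //; first by rewrite det1 oner_neq0.
  by move=> j i l; rewrite mulmx1 mul1r.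
move=> bad; have [x [i0 [xi0 bx]]] : exists x i0, res ((x : 'cV[R]_n.+1) i0 0) != 0 /\ ~ good x.
  apply: NNPP => nex; apply: bad => x i0 xi0; apply: NNPP => ng.
  by apply: nex; exists x, i0.
pose Z (j : 'I_M) (i : 'I_n.+1) := res ((U j *m x) i 0) == 0.
pose P := pivot_mx i0 x.
(* Modulo [t], only column [i0] of [U j *m P] survives, and it is [U j *m x]. The rows in [Z] are
   thus divisible by [t]. *)
pose U1 j := \matrix_(i, l) if Z j i then dv ((U j *m P) i l) else (U j *m P) i l.
have U1E j i l : (U j *m P) i l = t ^+ Z j i * U1 j i l.
  rewrite [U1 j i l]mxE; case: (boolP (Z j i)) => [Zji|_]; last by rewrite mul1r.
  rewrite expr1 -dvK // mulmx_pivotE; case: eqP => _; first exact/eqP.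
  by rewrite rmorphM res_t mul0r.
have detP j : \det (U j) * (x i0 0 * t ^+ n) = t ^+ (\sum_i Z j i) * \det (U1 j).
  rewrite -det_pivot_mx -det_mulmx -/P.
  rewrite (_ : U j *m P = \matrix_(i, l) (t ^+ Z j i * U1 j i l)); last first.
    by apply/matrixP => i l; rewrite U1E mxE.
  by rewrite det_scale_rows prodrXr.
pose z := (\sum_j \sum_i Z j i)%N.
(* Since [x] is bad, fewer than [M] of the [M * n.+1] rows survive modulo [t]. The basis change adds
   [M * n] to the total order and the divisions remove [z], so the order strictly drops. *)
have z_gt : (M * n < z)%N.
  have zE : (z + #|nonvanishing U x| = M * n.+1)%N.
    rewrite -sum1dep_card big_mkcond -(pair_bigA _ (fun j i => if res ((U j *m x) i 0%R) != 0%R then 1 else 0)%N) /=.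
    rewrite -big_split /=; under eq_bigr do rewrite -big_split /=.
    rewrite -[M in RHS]card_ord -[n.+1 in RHS]card_ord -!sum1_card big_distrl /=.
    apply: eq_bigr => j _; rewrite big_distrr; apply: eq_bigr => i _ /=.
    by rewrite /Z; case: eqP.
  by move: bx; rewrite /good; move/negP; rewrite -ltnNge; lia.
have key : t ^+ (o + M * n) * (v * x i0 0 ^+ M) = t ^+ z * \prod_j \det (U1 j).
  rewrite -prodrXr -big_split /=; under eq_bigr do rewrite -detP.
  by rewrite big_split /= Uo prodr_const card_ord exprMn -exprM exprD [(n * M)%N]mulnC; ring.
have vx0 : res (v * x i0 0 ^+ M) != 0 by rewrite rmorphM rmorphXn mulf_neq0 ?expf_neq0.
have tX0 e : t ^+ e != 0 by rewrite expf_neq0.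
set w := (o + M * n)%N in key.
have {}z_gt : (w < z + o)%N by rewrite /w; lia.
(* If [z] exceeded [w], then [t] would divide [v * x i0 0 ^+ M], which is nonzero modulo [t]. *)
have [lez|ltz] := leqP z w; last first.
  move: key; rewrite -(subnKC (ltnW ltz)) exprD -mulrA => /(mulfI (tX0 _)) E.
  by move: vx0; rewrite E rmorphM rmorphXn res_t expr0n subn_eq0 leqNgt ltz /= mul0r eqxx.
have lto : (w - z < o)%N by lia.
move: key; rewrite -(subnKC lez) exprD -mulrA => /(mulfI (tX0 _)) /esym E.
have [g [U' [e [g0 U'E U'good]]]] := IH _ lto _ _ vx0 E.
exists (P *m g), U', (fun j i => Z j i + e j i)%N; split=> //.
  rewrite det_mulmx det_pivot_mx !mulf_neq0 //.
  by apply: contraNneq xi0 => ->; rewrite rmorph0.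
move=> j i l; rewrite exprD -mulrA -U'E mulmxA !mxE big_distrr /=.
by apply: eq_bigr => a _; rewrite U1E mulrA.
Qed.

End Lattices.

(** * Denominators and extraction of bases *)

Section Fractions.

Import GRing.Theory.
Local Open Scope ring_scope.

(** [S] singles out the elements known to be quotients: all of them in a fraction field, the image
    of a map in [map_cuttable_fractions]. *)
Lemma common_denominator (R : comNzRingType) (F : idomainType) (S : F -> Prop)
    (phi : {rmorphism R -> F}) (I : finType) (x : I -> F) :
  (forall a, S a -> exists d n, phi d != 0 /\ a * phi d = phi n) ->
  (forall i, S (x i)) ->
  exists d (y : I -> R), phi d != 0 /\ forall i, x i * phi d = phi (y i).
Proof.
move=> hS Sx; have [d hd] := choice_fun (fun i => hS _ (Sx i)).
have [n hn] := choice_fun hd; exists (\prod_i d i), (fun i => n i * \prod_(j | j != i) d j).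
split=> [|i]; first by rewrite rmorph_prod; apply/prodf_neq0 => i _; case: (hn i).
by rewrite (bigD1 i) //= !rmorphM mulrA; case: (hn i) => _ ->.
Qed.

Lemma fractionE (R : idomainType) (x : {fraction R}) :
  exists d n, tofrac d != 0 /\ x * tofrac d = tofrac n.
Proof.
elim/quotW: x => x; exists \d_x, \n_x; rewrite tofrac_eq0 denom_ratioP; split=> //.
apply/eqP; rewrite -[_ * _]/(FracField.mul _ _) !piE.
by rewrite FracField.equivfE /FracField.mulf !numden_Ratio ?oner_eq0 ?mulf_neq0 ?denom_ratioP ?oner_eq0 // !mulr1 mulrC.
Qed.

Variables (R : idomainType) (n : nat).

(** The rank over the fraction field decides: a kernel vector comes back to [R] by clearing
    denominators, and full rank allows [n] independent rows to be selected. *)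
Lemma dependent_or_basis (B : seq 'rV[R]_n) :
  (exists v : 'cV[R]_n, v != 0 /\ forall y, y \in B -> y *m v = 0) \/
  (exists (W : 'M[R]_n) (D : seq 'rV[R]_n),
     \det W != 0 /\ perm_eq B ([seq row i W | i <- enum 'I_n] ++ D)).
Proof.
pose A0 : 'M[R]_(size B, n) := \matrix_(i < size B) B`_i.
pose A := map_mx (@tofrac R) A0.
have [fullA|nfullA] := boolP (row_full A); [right|left].
  pose f := fullrankfun fullA; have finj : injective f := @fullrankfun_inj _ _ _ _ fullA.
  exists (rowsub f A0).
  exists [seq B`_i | i : 'I_(size B) <- enum 'I_(size B) & i \notin codom f]; split.
    have := fullrowsub_unit fullA; rewrite -/f -map_mxsub unitmxE unitfE.
    by rewrite det_map_mx tofrac_eq0.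
  have -> : [seq row i (rowsub f A0) | i <- enum 'I_n] = [seq B`_i | i : 'I_(size B) <- codom f].
    rewrite /codom /image_mem -map_comp; apply: eq_map => i /=.
    by apply/rowP => l; rewrite !mxE.
  rewrite -{1}(mkseq_nth 0 B) /mkseq -val_enum_ord -map_comp -map_cat.
  apply: perm_map; apply: uniq_perm; first exact: enum_uniq.
    rewrite cat_uniq map_inj_uniq // enum_uniq filter_uniq ?enum_uniq // andbT.
    by apply/hasPn => i; rewrite mem_filter => /andP[].
  move=> i; have iB : i \in enum 'I_(size B) by rewrite mem_enum.
  rewrite [LHS]iB mem_cat mem_filter iB andbT.
  by case: (_ \in _).
have coker0 : cokermx A <> 0 by apply/eqP; rewrite cokermx_eq0.
have [j vj0] : exists j, col j (cokermx A) != 0.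
  apply: NNPP => h; apply: coker0; apply/matrixP => i j; rewrite mxE.
  apply/eqP; apply: contra_notT h => nz; exists j; apply: contraNneq nz => /colP /(_ i).
  by rewrite !mxE => ->.
have Av : A *m col j (cokermx A) = 0 by rewrite colE mulmxA mulmx_coker mul0mx.
set v := col j _ in vj0 Av.
have [d [y [d0 hy]]] := common_denominator (phi := @tofrac R) (S := fun=> True)
   (x := fun i => v i 0) (fun a _ => fractionE a) (fun=> I).
exists (\col_i y i); split.
  apply: contraNneq vj0 => /colP y0; apply/eqP/colP => i; rewrite [RHS]mxE.
  by apply: (mulIf d0); rewrite mul0r hy; have := y0 i; rewrite !mxE => ->; rewrite rmorph0.
move=> b bB; suff /matrixP h : map_mx (@tofrac R) (b *m \col_i y i) = 0.
  apply/matrixP => i l; apply/eqP; rewrite [X in _ == X]mxE -tofrac_eq0.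
  by have := h i l; rewrite mxE [RHS]mxE => ->.
have -> : b = row (Ordinal (etrans (index_mem b B) bB)) A0.
  by apply/rowP => l; rewrite !mxE nth_index.
rewrite map_mxM map_row -/A.
have -> : map_mx (@tofrac R) (\col_i y i) = tofrac d *: v.
  by apply/colP => i; rewrite mxE [RHS]mxE mulrC hy mxE.
by rewrite -scalemxAr -row_mul Av linear0 scaler0.
Qed.

(** Bases are removed greedily until the rest is degenerate; [0 < n] makes the list shrink each
    time. *)
Lemma disjoint_bases (B : seq 'rV[R]_n) : (0 < n)%N ->
  exists (Ws : seq 'M[R]_n) (D : seq 'rV[R]_n) (v : 'cV[R]_n),
    [/\ all (fun W => \det W != 0) Ws,
        perm_eq B (flatten [seq [seq row i W | i <- enum 'I_n] | W <- Ws] ++ D),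
        v != 0 & forall y, y \in D -> y *m v = 0].
Proof.
move=> n0; have [s] := ubnP (size B); elim: s B => // s IH B.
rewrite ltnS => leBs; have [[v [v0 hv]]|[W [D [W0 BD]]]] := dependent_or_basis B.
  by exists [::], B, v; split.
have [|Ws [D' [v [Ws0 DD' v0 hv]]]] := IH D.
  apply: leq_trans leBs; rewrite (perm_size BD) size_cat size_map size_enum_ord.
  by rewrite -[X in (X < _)%N]add0n ltn_add2r.
exists (W :: Ws), D', v; split=> //=; first by rewrite W0.
by rewrite (perm_trans BD) // -catA perm_cat2l.
Qed.

End Fractions.

(** * Lifting linear cuttings from the residue field *)

Section LinearIncidences.

Import GRing.Theory.
Local Open Scope ring_scope.

Definition lin_inc (R : pzRingType) (N : nat) (x : 'cV[R]_N) (y : 'rV[R]_N) : Prop :=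
  y *m x = 0.

Definition lin_cuttable (R : pzRingType) : Prop :=
  forall N, cuttable (@lin_inc R N).

(** As [y] kills [v], it factors through the quotient by [v], realized by projecting along [v] onto
    the coordinate hyperplane of [i0]. Scaling by [v i0 0] avoids division. *)
Lemma lin_inc_hyperplane (R : idomainType) n (v : 'cV[R]_n.+1) i0 x y :
  v i0 0 != 0 -> y *m v = 0 ->
  lin_inc x y <-> lin_inc (row' i0 (v i0 0 *: x - x i0 0 *: v)) (col' i0 y).
Proof.
move=> vi0 yv; rewrite /lin_inc.
have -> : col' i0 y *m row' i0 (v i0 0 *: x - x i0 0 *: v) = v i0 0 *: (y *m x).
  rewrite -[RHS]subr0 -(scaler0 _ (x i0 0)) -yv !scalemxAr -mulmxBr.
  apply/matrixP => i j; rewrite !mxE (bigD1_ord i0) //= !mxE !ord1.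
  rewrite [v _ _ * _]mulrC subrr mulr0 add0r.
  by apply: eq_bigr => l _; rewrite !mxE.
split=> [->|/eqP]; first by rewrite scaler0.
by rewrite scalemx_eq0 (negPf vi0) => /eqP.
Qed.

Variables (R : idomainType) (k : fieldType) (res : {rmorphism R -> k}).
Variables (t : R) (dv : R -> R).
Hypotheses (t_neq0 : t != 0) (res_t : res t = 0).
Hypothesis dvK : forall x, res x = 0 -> x = t * dv x.
Hypothesis res_val : forall x, x != 0 -> exists e y, x = t ^+ e * y /\ res y != 0.

(** Division by [t] stops because it lowers the order of one chosen nonzero coordinate. *)
Lemma primitive_vector N (x : 'cV[R]_N) : x != 0 ->
  exists e (y : 'cV[R]_N) i, x = t ^+ e *: y /\ res (y i 0) != 0.
Proof.
move=> x0; have [i xi0] : exists i, x i 0 != 0.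
  apply: NNPP => h; move/eqP: x0; apply; apply/colP => i; rewrite mxE.
  by apply/eqP; apply: contra_notT h => ?; exists i.
have [e [u [xu u0]]] := res_val xi0.
elim: e x {x0 xi0} xu => [|e IH] x xu.
  by exists 0%N, x, i; rewrite scale1r xu mul1r.
have [[j xj0]|h] := excluded_middle_informative (exists j, res (x j 0) != 0).
  by exists 0%N, x, j; rewrite scale1r.
have xE : x = t *: \col_j dv (x j 0).
  apply/colP => j; rewrite !mxE -dvK //; apply/eqP.
  by apply: contra_notT h => ?; exists j.
have [|e' [y [j [yE yj]]]] := IH (\col_j dv (x j 0)).
  apply: (mulfI t_neq0); rewrite mulrA -exprS -xu.
  by rewrite [in RHS]xE !mxE.
by exists e'.+1, y, j; rewrite exprS -scalerA -yE.
Qed.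

(** A nonzero vector goes to its primitive representative in the semistable lattice, then modulo [t]
    to a cell over [k]. Fix a nonzero [x0] in a cell: at least [M] rows are nonzero modulo [t] at
    its representative. Such a row vanishes at another vector of the cell only if its reduction
    crosses the cell over [k], and the proportion 1/(2(n+1)) allows this for at most [M / 2] rows.
    So at least [M / 2] rows do not cross. *)
Lemma lattice_cutting n : lin_cuttable k -> exists T, forall M (U : 'I_M -> 'M[R]_n.+1),
  (forall j, \det (U j) != 0) ->
  exists c : 'cV[R]_n.+1 -> nat, (forall x, c x < T)%N /\ forall p,
   (2 * #|[set ji : 'I_M * 'I_n.+1 | pbool (crossing (@lin_inc R _) c p (row ji.2 (U ji.1)))]|
      + M <= 2 * (M * n.+1))%N.
Proof.
move=> /(_ n.+1 (2 * n.+1)%N) [Tk hTk]; exists Tk.+1 => M U U0.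
have /res_val [o [v [Uo v0]]] : \prod_j \det (U j) != 0 by apply/prodf_neq0.
have [g [U' [e [g0 U'E U'good]]]] := semistable_lattice t_neq0 res_t dvK v0 Uo.
(* [\adj g] serves as an inverse of [g]: the nonzero factor [\det g] does not affect incidence. *)
have /choice_fun [z hz] : forall x, exists z : 'cV[R]_n.+1, x != 0 -> exists l i,
    \adj g *m x = t ^+ l *: z /\ res (z i 0) != 0.
  move=> x; have [->|x0] := eqVneq x 0; first by exists 0.
  have : \adj g *m x != 0.
    apply: contraNneq x0 => ax; have : g *m (\adj g *m x) == 0 by rewrite ax mulmx0.
    by rewrite mulmxA mul_mx_adj mul_scalar_mx scalemx_eq0 (negPf g0).
  by move=> /primitive_vector [l [z [i h]]]; exists z => _; exists l, i.
have zinc x j i : x != 0 ->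
    lin_inc x (row i (U j)) <-> (U' j *m z x) i 0 = 0.
  move=> /hz [l [i0 [zE zi0]]].
  have E : \det g * (row i (U j) *m x) 0 0 = t ^+ (l + e j i) * (U' j *m z x) i 0.
    have -> : \det g * (row i (U j) *m x) 0 0 = (U j *m (g *m (\adj g *m x))) i 0.
      by rewrite [g *m _]mulmxA mul_mx_adj mul_scalar_mx -scalemxAr -row_mul !mxE.
    rewrite zE -!scalemxAr mulmxA mxE exprD -mulrA; congr (_ * _).
    by rewrite !mxE big_distrr; apply: eq_bigr => a _ /=; rewrite U'E mulrA.
  rewrite /lin_inc; split=> h.
    by move: E; rewrite h mxE mulr0 => /esym/eqP; rewrite mulf_eq0 expf_eq0 (negPf t_neq0) andbF => /eqP.
  move/eqP: E; rewrite h mulr0 mulf_eq0 (negPf g0) /= => /eqP E.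
  by apply/matrixP => a b; rewrite !ord1 E mxE.
pose L := enum [set: 'I_M * 'I_n.+1].
pose yk (ji : 'I_M * 'I_n.+1) := row ji.2 (map_mx res (U' ji.1)).
have [c [cT hc]] := hTk (map yk L).
(* The extra cell [Tk] holds only the zero vector, which has no primitive representative. *)
exists (fun x => if x == 0 then Tk else c (map_mx res (z x))); split=> [x|p].
  by case: eqP => _ //; apply: ltnW; rewrite ltnS.
set X := [set ji | _].
have [->|[ji]] := set_0Vmem X; first by rewrite cards0; lia.
rewrite inE => /pboolP [_ [x0 [_ cx0 _ nx0]]].
have x00 : x0 != 0 by apply: contra_notN nx0 => /eqP ->; rewrite /lin_inc mulmx0.
rewrite (negPf x00) in cx0.
pose V := nonvanishing res U' (z x0).
have V_ge : (M <= #|V|)%N.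
  by have [l [i [_ zi]]] := hz _ x00; apply: U'good zi.
pose Xk := [set ji | pbool (crossing (@lin_inc k _) c p (yk ji))].
have Xk_le : (2 * #|Xk| <= M)%N.
  have := hc p; rewrite /crossings count_map size_map -cardE cardsT card_prod !card_ord.
  have -> : count (fun ji => pbool (crossing (@lin_inc k _) c p (yk ji))) L = #|Xk|.
    by rewrite /L enum_setT cardE /enum_mem size_filter; apply: eq_count => ji'; rewrite /= inE.
  by rewrite mul1n mulnAC leq_pmul2r.
have sub : X \subset ~: V :|: Xk.
  apply/subsetP => [[j i]]; rewrite !inE => /pboolP [x [x' [cx cx' ix nix']]].
  apply/orP; have [Vji|] := boolP (res _ != 0); [right|by left].
  apply/pboolP; exists (map_mx res (z x)), (map_mx res (z x0)).
  have resE w : yk (j, i) *m map_mx res (z w) = \matrix_(_, _) res ((U' j *m z w) i 0).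
    apply/matrixP => a b; rewrite /yk -map_row -map_mxM -row_mul !mxE !ord1.
    by [].
  have [x0'|xn0] := eqVneq x 0.
    by move: cx cx0; rewrite x0' eqxx => <- ck; have := cT (map_mx res (z x0)); rewrite ck ltnn.
  rewrite (negPf xn0) in cx; split=> //.
    rewrite /lin_inc resE; apply/matrixP => a b; rewrite !mxE.
    by have /= := (zinc x j i xn0).1 ix; rewrite mxE => ->; rewrite rmorph0.
  rewrite /lin_inc resE => /matrixP /(_ 0 0); rewrite !mxE => h.
  by move: Vji; rewrite mxE h eqxx.
have := leq_trans (subset_leq_card sub) (leq_card_setU _ _).
have := cardsC V; rewrite card_prod !card_ord.
move: V_ge Xk_le; move: #|V| #|Xk| #|~: V| #|X| (M * n.+1)%N => a b a' e' w; lia.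
Qed.

Lemma count_sub_in (T : eqType) (s : seq T) (a b : pred T) :
  (forall y, y \in s -> a y -> b y) -> (count a s <= count b s)%N.
Proof.
elim: s => //= y s IH h; apply: leq_add; last first.
  by apply: IH => z zs; apply: h; rewrite in_cons zs orbT.
by case ay: (a y) => //; rewrite (h y) ?mem_head.
Qed.

Lemma count_rows n (Ws : seq 'M[R]_n) (P : pred 'rV[R]_n) :
  count P (flatten [seq [seq row i W | i <- enum 'I_n] | W <- Ws]) =
  #|[set ji : 'I_(size Ws) * 'I_n | P (row ji.2 Ws`_ji.1)]|.
Proof.
have -> : flatten [seq [seq row i W | i <- enum 'I_n] | W <- Ws] =
    [seq row ji.2 Ws`_ji.1 | ji : 'I_(size Ws) * 'I_n <-
       [seq (j, i) | j <- enum 'I_(size Ws), i <- enum 'I_n]].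
  rewrite map_allpairs -{1}(mkseq_nth 0 Ws) /mkseq -val_enum_ord -!map_comp.
  by congr flatten.
have /permP LE : perm_eq [seq (j, i) | j <- enum 'I_(size Ws), i <- enum 'I_n]
    (Finite.enum ('I_(size Ws) * 'I_n)%type).
  apply: uniq_perm; [|by rewrite -enumT enum_uniq|].
    by apply: allpairs_uniq; rewrite ?enum_uniq // => -[? ?] [? ?].
  by move=> [j i]; rewrite -enumT mem_enum; apply/allpairsP; exists (j, i); rewrite !mem_enum.
rewrite count_map LE cardE /enum_mem size_filter.
by apply: eq_count => ji; rewrite /= inE.
Qed.

(* Either at least half of the functionals split into disjoint bases, or at
   least half of them vanish at a common vector. *)
Lemma lin_cuttable_residue : lin_cuttable k -> lin_cuttable R.
Proof.
(* Any proportion below 1 is enough, so it may worsen at each step of the induction on the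
   dimension. *)
move=> hk; suff h n : exists T a r, (a < r)%N /\ cutting (@lin_inc R n) T a r.
  by move=> n; have [T [a [r [ar /cuttable_of_cutting]]]] := h n; apply.
elim: n => [|n [T' [a' [r' [ar' h']]]]].
  exists 1%N, 0%N, 1%N; split=> // B; exists (fun=> 0%N); split=> // i.
  by rewrite crossings_eq0 // => y [x [x' [_ _ _]]]; case; rewrite /lin_inc thinmx0 mul0mx.
have [T2 h2] := lattice_cutting n hk.
(* Two proportions over a common denominator. If at least half of the functionals lie in [D], the
   induction hypothesis gives (r' + a')/(2r'), even if all the others cross. If more than half lie
   in bases, the [size Ws / 2] rows saved give 1 - 1/(4(n+1)). *)
exists (T' + T2)%N, (maxn (4 * n.+1 * (r' + a')) (2 * r' * (4 * n.+1).-1))%N, (4 * n.+1 * (2 * r'))%N.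
split; first by rewrite gtn_max; apply/andP; split; nia.
move=> B; have [Ws [D [v [Ws0 BD v0 Dv]]]] := disjoint_bases B (ltn0Sn n).
have sizeB : size B = (size Ws * n.+1 + size D)%N.
  rewrite (perm_size BD) size_cat size_flatten; congr (_ + _)%N.
  by elim: (Ws) => //= W s ->; rewrite size_map size_enum_ord.
have crossB c p : crossings (@lin_inc R _) c p B =
  (#|[set ji : 'I_(size Ws) * 'I_n.+1 | pbool (crossing (@lin_inc R _) c p (row ji.2 Ws`_ji.1))]|
   + crossings (@lin_inc R _) c p D)%N.
  by rewrite /crossings (permP BD) count_cat count_rows.
have [halfD|halfB] := leqP (size B) (2 * size D).
  have [i0 vi0] : exists i, v i 0 != 0.
    apply: NNPP => h; move/eqP: v0; apply; apply/colP => i; rewrite mxE.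
    by apply/eqP; apply: contra_notT h => ?; exists i.
  have [c [cT hc]] := h' (map (col' i0) D).
  pose f (x : 'cV[R]_n.+1) := row' i0 (v i0 0 *: x - x i0 0 *: v).
  exists (c \o f); split=> [x|p]; first by apply: leq_trans (cT _) _; apply: leq_addr.
  rewrite crossB; set C1 := #|_|; set C2 := crossings _ _ _ D.
  have := hc p; rewrite size_map; set C3 := crossings _ _ _ _ => le3.
  have le1 : (C2 <= C3)%N.
    rewrite /C3 /crossings count_map; apply: count_sub_in => y yD /pboolP [x [x' [cx cx' ix nix]]] /=.
    apply/pboolP; exists (f x), (f x'); split=> //; rewrite /f.
      by apply/(lin_inc_hyperplane _ vi0) => //; apply: Dv.
    by move/(lin_inc_hyperplane _ vi0 (Dv _ yD)).
  have le2 : (C1 <= size Ws * n.+1)%N.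
    by apply: leq_trans (max_card _) _; rewrite card_prod !card_ord.
  apply: leq_trans (leq_mul (leq_maxl _ _) (leqnn _)).
  rewrite -!mulnA leq_mul2l; apply/orP; right; rewrite leq_mul2l; apply/orP; right.
  move: sizeB halfD le2 le3; move: (size B) (size D) (size Ws * _)%N => b d w -> hd lew le3.
  have : (r' * C2 <= a' * d)%N by apply: leq_trans le3; rewrite leq_mul2l le1 orbT.
  have : (r' * C1 <= r' * w)%N by rewrite leq_mul2l lew orbT.
  have : (r' * w + a' * d <= r' * d + a' * w)%N.
    by rewrite -(subnKC (ltnW ar')); have : (w <= d)%N by [lia]; nia.
  lia.
have [c [cT hc]] := h2 (size Ws) (fun j => Ws`_j) (fun j => all_nthP 0 Ws0 _ (ltn_ord j)).
exists c; split=> [x|p]; first exact: leq_trans (cT x) (leq_addl _ _).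
have := hc p; rewrite crossB; set C1 := #|_|; set C2 := crossings _ _ _ D => le1.
have le2 : (C2 <= size D)%N by apply: count_size.
apply: leq_trans (leq_mul (leq_maxr _ _) (leqnn _)).
rewrite mulnAC [X in (X <= _)%N]mulnC -[X in (_ <= X)%N]mulnA leq_mul2l; apply/orP; right.
move: sizeB halfB le1 le2; rewrite [(4 * n.+1)%N]mulnC.
move: (size B) (size D) (size Ws) => b d s -> hd le1 le2.
have : (n.+1 * (2 * C1 + s) <= n.+1 * (2 * (s * n.+1)))%N by rewrite leq_mul2l le1 orbT.
have : (n.+1 * C2 <= n.+1 * d)%N by rewrite leq_mul2l le2 orbT.
move: hd; rewrite -subn1 mulnBl mul1n mulnDr [(s * n.+1)%N]mulnC.
move: (n.+1 * s)%N => w; rewrite !mulnDr; lia.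
Qed.

End LinearIncidences.

(** * Polynomial rings, fractions and finite extensions *)

Section FieldExtensions.

Import GRing.Theory.
Local Open Scope ring_scope.

Lemma lin_cuttable_poly (k : fieldType) : lin_cuttable k -> lin_cuttable {poly k}.
Proof.
apply: (@lin_cuttable_residue {poly k} k (horner_eval 0) 'X (fun p => p %/ 'X)).
- by rewrite polyX_eq0.
- by rewrite /= /horner_eval hornerX.
- move=> p /eqP p0; rewrite mulrC divpK // -['X]subr0 -polyC0 dvdp_XsubCl.
  exact: p0.
- move=> p p0; have [m [q]] := multiplicity_XsubC p 0.
  rewrite p0 /= => q0 ->; exists m, q; rewrite subr0 mulrC; split=> //.
Qed.

(** Incidence is tested in [F] while the coordinates are only names in [A]. Fractions and finite
    extensions can thus be compared inside one ambient field. *)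
Definition map_inc (A : Type) (F : pzRingType) (phi : A -> F) (I : finType)
    (x y : I -> A) : Prop :=
  \sum_i phi (x i) * phi (y i) = 0.

Definition map_cuttable (A : Type) (F : pzRingType) (phi : A -> F) : Prop :=
  forall I : finType, cuttable (@map_inc A F phi I).

Lemma map_cuttable_inj (R F : comPzRingType) (phi : {rmorphism R -> F}) :
  injective phi -> lin_cuttable R -> map_cuttable phi.
Proof.
move=> phi_inj hR I; apply: cuttable_pull (hR #|I|).
pose v : 'I_#|I| -> I := @enum_val I I.
exists (fun x => \col_j x (v j)), (fun y => \row_j y (v j)) => x y.
have E : \sum_i phi (x i) * phi (y i) =
    phi ((\row_j y (v j) *m \col_j x (v j)) 0 0).
    rewrite mxE rmorph_sum (reindex v) /=; last exact: onW_bij (enum_val_bij I).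
  by apply: eq_bigr => j _; rewrite !mxE rmorphM mulrC.
rewrite /map_inc /lin_inc E; split=> [|->]; last by rewrite mxE rmorph0.
by rewrite -[X in _ = X](rmorph0 phi) => /phi_inj h; apply/matrixP => i j; rewrite !ord1 h mxE.
Qed.

Lemma lin_cuttable_sub (R F : comPzRingType) (phi : {rmorphism R -> F}) :
  injective phi -> map_cuttable phi -> lin_cuttable R.
Proof.
move=> phi_inj hphi N; apply: cuttable_pull (hphi 'I_N).
exists (fun x i => x i 0), (fun y i => y 0 i) => x y.
have E : \sum_i phi (x i 0) * phi (y 0 i) = phi ((y *m x) 0 0).
  by rewrite mxE rmorph_sum; apply: eq_bigr => i _; rewrite rmorphM mulrC.
rewrite /map_inc /lin_inc E; split=> [->|]; first by rewrite mxE rmorph0.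
by rewrite -[X in _ = X](rmorph0 phi) => /phi_inj h; apply/matrixP => i j; rewrite !ord1 h mxE.
Qed.

(** Multiplying all entries of [x], or of [y], by one nonzero denominator does not change whether
    the sum vanishes. *)
Lemma map_cuttable_fractions (R : comNzRingType) (F : fieldType)
    (phi : {rmorphism R -> F}) (A : Type) (psi : A -> F) :
  (forall a, exists d n, phi d != 0 /\ psi a * phi d = phi n) ->
  map_cuttable phi -> map_cuttable psi.
Proof.
move=> hpsi hphi I; apply: cuttable_pull (hphi I).
have /choice_fun [f hf] : forall x : I -> A, exists y : I -> R, exists d,
    phi d != 0 /\ forall i, psi (x i) * phi d = phi (y i).
  move=> x; have [||d [y h]] := @common_denominator R F (fun u => exists a, u = psi a) phi I (psi \o x).
  - by move=> _ [a ->].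
  - by move=> i; exists (x i).
  by exists y, d.
exists f, f => x y; have [d [d0 fx]] := hf x; have [e [e0 fy]] := hf y.
rewrite /map_inc; under [X in _ <-> X = 0]eq_bigr do rewrite -fx -fy mulrACA.
rewrite -big_distrl /=; split=> [->|/eqP]; first by rewrite mul0r.
by rewrite mulf_eq0 (negPf (mulf_neq0 d0 e0)) orbF => /eqP.
Qed.

(** Restriction of scalars: in the basis [phi (b m)] over [k], one equation becomes [D] equations
    over [k]. Each is bilinear in the coordinates of the [x i] and those of the products
    [b l * y i], hence a linear incidence indexed by [I * 'I_D]. *)
Lemma map_cuttable_finite (k F : fieldType) (iota : {rmorphism k -> F})
    (R : comNzRingType) (phi : {rmorphism R -> F}) (D : nat) (b : 'I_D -> R) :
  (forall p, exists c : 'I_D -> k, phi p = \sum_m iota (c m) * phi (b m)) ->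
  (forall c : 'I_D -> k, \sum_m iota (c m) * phi (b m) = 0 -> forall m, c m = 0) ->
  lin_cuttable k -> map_cuttable phi.
Proof.
move=> /choice_fun [c hc] indep hk I.
have hid : map_cuttable (@idfun k) by apply: map_cuttable_inj.
pose J (m : 'I_D) (x y : I -> R) :=
  map_inc (@idfun k) (fun il : I * 'I_D => c (x il.1) il.2)
    (fun il : I * 'I_D => c (b il.2 * y il.1) m).
apply: cuttable_pull (@cuttable_all _ _ _ (enum 'I_D) J _); last first.
  move=> m; apply: cuttable_pull (hid (I * 'I_D)%type).
  exists (fun x il => c (x il.1) il.2), (fun y il => c (b il.2 * y il.1) m).
  by [].
exists id, id => x y; rewrite /map_inc.
have -> : \sum_i phi (x i) * phi (y i) =
   \sum_m iota (\sum_(il : I * 'I_D) c (x il.1) il.2 * c (b il.2 * y il.1) m) * phi (b m).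
  under [RHS]eq_bigr do rewrite rmorph_sum big_distrl /=.
  rewrite exchange_big /= -(pair_bigA _ (fun i l => \sum_m iota (c (x i) l * c (b l * y i) m) * phi (b m))) /=.
  apply: eq_bigr => i _; rewrite [phi (x i)]hc big_distrl /=; apply: eq_bigr => l _.
  rewrite -mulrA -rmorphM hc big_distrr /=.
  by apply: eq_bigr => m _; rewrite rmorphM mulrA.
split=> [/indep h m _|h]; first exact: h.
by rewrite big1 // => m _; rewrite (h m) ?mem_enum // rmorph0 mul0r.
Qed.

Section SimpleExtension.

Variables (k K : fieldType) (iota : {rmorphism k -> K}) (a : K).

Definition ev : {poly k} -> K := horner_morph (fun x => mulrC a (iota x)).
HB.instance Definition _ := GRing.RMorphism.on ev.

(** For transcendental [a], [ev] is injective and the polynomial ring itself is used. For algebraic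
    [a], an annihilator of least degree makes the lower powers of [a] a basis of the image over
    [k]. *)
Lemma map_cuttable_ev : lin_cuttable k -> map_cuttable ev.
Proof.
move=> hk; have [[p0 [p00 evp0]]|alg] := excluded_middle_informative
   (exists p0 : {poly k}, p0 != 0 /\ ev p0 = 0); last first.
  apply: map_cuttable_inj (lin_cuttable_poly hk) => p q pq.
  apply/eqP; rewrite -subr_eq0; apply: contra_notT alg => pq0.
  by exists (p - q); rewrite pq0 rmorphB /= pq subrr.
have [D] := ubnP (size p0); elim: D p0 p00 evp0 => // D IH p0 p00 evp0.
rewrite ltnS => le0.
have [[p1 [p10 evp1 lt1]]|min] := excluded_middle_informative
   (exists p1 : {poly k}, [/\ p1 != 0, ev p1 = 0 & (size p1 < size p0)%N]).
  by apply: IH evp1 _ => //; apply: leq_trans lt1 le0.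
have evE n (c : 'I_n -> k) : ev (\sum_(m < n) c m *: 'X^m) =
   \sum_m iota (c m) * ev 'X^m.
  rewrite rmorph_sum; apply: eq_bigr => m _.
  by rewrite -mul_polyC rmorphM /=; congr (_ * _); rewrite /ev horner_morphC.
apply: (map_cuttable_finite (iota := iota) (D := (size p0).-1) (b := fun m => 'X^m)) hk => [p|c].
  exists (fun m => (p %% p0)`_m).
  rewrite {1}(divp_eq p p0) rmorphD rmorphM /= evp0 mulr0 add0r -evE; congr (ev _).
  rewrite -(poly_def (size p0).-1 (fun m => (p %% p0)`_m)).
  apply/polyP => m; rewrite coef_poly; case: ltnP => // le; rewrite nth_default //.
  by apply: leq_trans le; have := ltn_modpN0 p p00; case: (size p0).
rewrite -evE => ev0 m; pose q := \sum_(m < (size p0).-1) c m *: 'X^m : {poly k}.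
have q0 : q = 0.
  apply: NNPP => /eqP q0; apply: min; exists q; split=> //.
  have p0_gt0 : (0 < size p0)%N by rewrite size_poly_gt0.
  rewrite -(ltn_predK p0_gt0) ltnS; apply: leq_trans (size_sum _ _ _) _.
  by apply/bigmax_leqP => l _; apply: leq_trans (size_scale_leq _ _) _; rewrite size_polyXn.
have := congr1 (fun r : {poly k} => r`_m) q0; rewrite coef_sum coef0 (bigD1 m) //=.
rewrite coefZ coefXn eqxx mulr1 big1 ?addr0 // => l lm.
by rewrite coefZ coefXn eq_sym (inj_eq val_inj) (negPf lm) mulr0.
Qed.

End SimpleExtension.
End FieldExtensions.

(** * Subfields as field types *)

Section SubfieldType.

Import GRing.Theory.
Local Open Scope ring_scope.

Variables (K : fieldType) (S : K -> Prop).

Definition subfield_pred (_ : is_subfield S) : pred K := fun x => pbool (S x).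

Variable hS : is_subfield S.

Fact subfield_pred_closed : GRing.divring_closed (subfield_pred hS).
Proof.
have [S0 [S1 [SD [SN [SM SV]]]]] := hS; split=> [|x y|x y]; rewrite -!topredE /=.
- exact/pboolP.
- by move=> /pboolP Sx /pboolP Sy; apply/pboolP; apply/SD/SN.
- by move=> /pboolP Sx /pboolP Sy; apply/pboolP; apply/SM/SV.
Qed.

HB.instance Definition _ :=
  GRing.isDivringClosed.Build K (subfield_pred hS) subfield_pred_closed.

Record subfield_type := SubfieldElt {
  subfield_val : K; _ : subfield_val \in subfield_pred hS }.

HB.instance Definition _ := [isSub for subfield_val].
HB.instance Definition _ := [Choice of subfield_type by <:].
HB.instance Definition _ := [SubChoice_isSubIntegralDomain of subfield_type by <:].
HB.instance Definition _ := [SubIntegralDomain_isSubField of subfield_type by <:].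

Lemma subfield_typeP x : S x -> exists u : subfield_type, val u = x.
Proof. by move=> /pboolP Sx; exists (SubfieldElt Sx). Qed.

Lemma subfield_valP (u : subfield_type) : S (val u).
Proof. by apply/pboolP; apply: (valP u). Qed.

End SubfieldType.

(** * Finitely generated fields *)

Section FinitelyGenerated.

Import GRing.Theory.
Local Open Scope ring_scope.

Lemma subfield_range (k K : fieldType) (iota : {rmorphism k -> K}) :
  is_subfield (fun x => exists u, iota u = x).
Proof.
split; first by exists 0; rewrite rmorph0.
split; first by exists 1; rewrite rmorph1.
split; first by move=> _ _ [u <-] [v <-]; exists (u + v); rewrite rmorphD.
split; first by move=> _ [u <-]; exists (- u); rewrite rmorphN.
split; first by move=> _ _ [u <-] [v <-]; exists (u * v); rewrite rmorphM.
by move=> _ [u <-]; exists u^-1; rewrite fmorphV.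
Qed.

Lemma subfield_quotients (R : comNzRingType) (K : fieldType) (phi : {rmorphism R -> K}) :
  is_subfield (fun x => exists d n, phi d != 0 /\ x * phi d = phi n).
Proof.
split; first by exists 1, 0; rewrite rmorph0 rmorph1 oner_neq0 mul0r.
split; first by exists 1, 1; rewrite rmorph1 oner_neq0 mul1r.
split.
  move=> x y [d [n [d0 xd]]] [e [m [e0 ye]]].
  exists (d * e), (n * e + m * d); rewrite rmorphD !rmorphM mulf_neq0 //.
  by split=> //; rewrite -xd -ye; ring.
split; first by move=> x [d [n [d0 xd]]]; exists d, (- n); rewrite mulNr xd rmorphN.
split.
  move=> x y [d [n [d0 xd]]] [e [m [e0 ye]]].
  exists (d * e), (n * m); rewrite !rmorphM mulf_neq0 //.
  by split=> //; rewrite -xd -ye; ring.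
move=> x [d [n [d0 xd]]]; have [->|x0] := eqVneq x 0.
  by exists 1, 0; rewrite rmorph0 rmorph1 oner_neq0 invr0 mul0r.
by exists n, d; rewrite -xd mulf_neq0 // mulKf.
Qed.

(** [k'] is k(a), realized inside [K] as the quotients of values at [a] of polynomials over [k]. *)
Lemma lin_cuttable_adjoin (k K : fieldType) (iota : {rmorphism k -> K}) (a : K) :
  lin_cuttable k ->
  exists (k' : fieldType) (iota' : {rmorphism k' -> K}),
    [/\ lin_cuttable k', forall u, exists u', iota' u' = iota u & exists u', iota' u' = a].
Proof.
move=> hk; pose phi : {rmorphism {poly k} -> K} := @ev k K iota a.
have hS := subfield_quotients phi.
exists (subfield_type hS), (val : {rmorphism subfield_type hS -> K}); split.
- apply: (lin_cuttable_sub (phi := val)); first exact: val_inj.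
  apply: map_cuttable_fractions (map_cuttable_ev iota a hk) => u.
  exact: subfield_valP u.
- move=> u; apply: subfield_typeP; exists 1, u%:P.
  by rewrite rmorph1 oner_neq0 mulr1 /phi /= /ev horner_morphC.
- apply: subfield_typeP; exists 1, 'X.
  by rewrite rmorph1 oner_neq0 mulr1 /phi /= /ev horner_morphX.
Qed.

(** With one cell per vector no range crosses a cell, and the number of vectors does not depend on
    [B]. *)
Lemma lin_cuttable_finite (k : finFieldType) : lin_cuttable k.
Proof.
move=> N r; exists #|{: 'cV[k]_N}| => B.
exists (fun x => nat_of_ord (enum_rank x)); split=> [x|i]; first exact: ltn_ord.
rewrite crossings_eq0 ?muln0 // => y [x [x' [ex ex' ix nix']]]; apply: nix'.
by rewrite (_ : x' = x) //; apply: enum_rank_inj; apply: val_inj; rewrite /= ex ex'.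
Qed.

Lemma lin_cuttable_fg (p : nat) (K : fieldType) :
  prime p -> fg_ext_of_Fp p K -> lin_cuttable K.
Proof.
move=> p_pr [pK [s hs]].
have [k [iota [hk ks]]] : exists (k : fieldType) (iota : {rmorphism k -> K}),
    lin_cuttable k /\ forall x, x \in s -> exists u, iota u = x.
  elim: s {hs} => [|a s [k [iota [hk ks]]]].
    pose L := pPrimeCharType pK.
    exists 'F_p, (in_alg L : {rmorphism 'F_p -> L}); split=> //.
    exact: lin_cuttable_finite.
  have [k' [iota' [hk' kk' ak']]] := lin_cuttable_adjoin iota a hk.
  exists k', iota'; split=> // x; rewrite in_cons => /predU1P [->//|/ks [u <-]].
  exact: kk'.
(* The image of the last field is a subfield containing the generators, hence all of [K]. *)
have surj := hs _ (subfield_range iota) ks.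
have hid : map_cuttable (@idfun K).
  apply: map_cuttable_fractions (map_cuttable_inj (fmorph_inj iota) hk) => x.
  by have [u <-] := surj x; exists 1, u; rewrite rmorph1 oner_neq0 mulr1.
by apply: lin_cuttable_sub hid.
Qed.

End FinitelyGenerated.

(** * Hilbert basis theorem *)

Section Noetherian.

Import GRing.Theory.
Local Open Scope ring_scope.

Definition is_ideal (R : comNzRingType) (I : R -> Prop) : Prop :=
  [/\ I 0, forall x y, I x -> I y -> I (x + y) & forall r x, I x -> I (r * x)].

(** Quantifying over the ideals that contain [s] avoids explicit linear combinations. *)
Definition in_span (R : comNzRingType) (s : seq R) (x : R) : Prop :=
  forall I, is_ideal I -> (forall y, y \in s -> I y) -> I x.

Definition noetherian (R : comNzRingType) : Prop :=
  forall I, is_ideal I -> exists s : seq R,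
    (forall x, x \in s -> I x) /\ forall x, I x -> in_span s x.

Lemma ex_seq_lift (T U : eqType) (Q : T -> U -> Prop) (s : seq T) :
  (forall x, x \in s -> exists y, Q x y) ->
  exists r : seq U, (forall y, y \in r -> exists2 x, x \in s & Q x y) /\
    forall x, x \in s -> exists2 y, y \in r & Q x y.
Proof.
elim: s => [|x s IH] h; first by exists [::].
have [|r [h1 h2]] := IH; first by move=> z zs; apply: h; rewrite in_cons zs orbT.
have [y xy] := h x (mem_head _ _).
exists (y :: r); split=> z; rewrite in_cons => /predU1P [->|].
- by exists x; rewrite ?mem_head.
- by move=> /h1 [w ws wz]; exists w; rewrite // in_cons ws orbT.
- by exists y; rewrite ?mem_head.
- by move=> /h2 [w ws wz]; exists w; rewrite // in_cons ws orbT.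
Qed.

Lemma noetherian_field (K : fieldType) : noetherian K.
Proof.
move=> I hI; have [[x [x0 Ix]]|h] := excluded_middle_informative (exists x, x != 0 /\ I x).
  exists [:: x]; split=> [y|y _ J [_ _ JM] Js]; first by rewrite inE => /eqP ->.
  by rewrite -[y](divfK x0); apply/JM/Js; rewrite mem_head.
exists [::]; split=> // x Ix J [J0 _ _] _; have [->//|x0] := eqVneq x 0.
by case: h; exists x.
Qed.

(* [lead_ideal I n] collects the coefficients in degree [n] of the elements of
   [I] of degree at most [n]. *)
Definition lead_ideal (R : comNzRingType) (I : {poly R} -> Prop) n : R -> Prop :=
  fun a => exists f, [/\ I f, (size f <= n.+1)%N & f`_n = a].

Lemma lead_ideal_is_ideal (R : comNzRingType) (I : {poly R} -> Prop) n :
  is_ideal I -> is_ideal (lead_ideal I n).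
Proof.
move=> [I0 ID IM]; split.
- by exists 0; rewrite size_poly0 coef0.
- move=> _ _ [f [If sf <-]] [g [Ig sg <-]]; exists (f + g); rewrite coefD.
  split=> //; first exact: ID.
  by apply: leq_trans (size_polyD _ _) _; rewrite geq_max sf sg.
- move=> r _ [f [If sf <-]]; exists (r%:P * f); rewrite coefCM.
  split=> //; first exact: IM.
  by rewrite mul_polyC (leq_trans (size_scale_leq _ _)).
Qed.

Lemma lead_ideal_leq (R : comNzRingType) (I : {poly R} -> Prop) n m a :
  is_ideal I -> (n <= m)%N -> lead_ideal I n a -> lead_ideal I m a.
Proof.
move=> [_ _ IM] nm [f [If sf <-]]; exists ('X^(m - n) * f); split.
- exact: IM.
- apply: leq_trans (size_polyMleq _ _) _; rewrite size_polyXn; lia.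
- by rewrite coefXnM ltnNge leq_subr /= subKn.
Qed.

Lemma noetherian_poly (R : comNzRingType) : noetherian R -> noetherian {poly R}.
Proof.
move=> hR I hI; have [I0 ID IM] := hI.
pose L a := exists n, lead_ideal I n a.
have hL : is_ideal L.
  split.
  - by exists 0%N; case: (lead_ideal_is_ideal 0 hI).
  - move=> x y [n Ix] [m Iy]; exists (maxn n m).
    have [_ + _] := lead_ideal_is_ideal (maxn n m) hI; apply.
      by apply: lead_ideal_leq Ix; rewrite // leq_maxl.
    by apply: lead_ideal_leq Iy; rewrite // leq_maxr.
  - by move=> r x [n Ix]; exists n; have [_ _] := lead_ideal_is_ideal n hI; apply.
have [s [sL Ls]] := hR _ hL.
(* [L] is the union of the increasing leading ideals; its finitely many generators all occur by
   degree [N], where the chain becomes stationary. *)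
have [N sN] : exists N, forall x, x \in s -> lead_ideal I N x.
  elim: s sL {Ls} => [|x s IH] sL; first by exists 0%N.
  have [|N hN] := IH; first by move=> y ys; apply: sL; rewrite in_cons ys orbT.
  have [m Ix] := sL x (mem_head _ _); exists (maxn N m) => y.
  rewrite in_cons => /predU1P [->|/hN Iy].
    by apply: lead_ideal_leq Ix; rewrite // leq_maxr.
  by apply: lead_ideal_leq Iy; rewrite // leq_maxl.
have /choice_fun [g hg] : forall n, exists g : seq {poly R},
    (forall f, f \in g -> I f) /\ forall J : {poly R} -> Prop, is_ideal J ->
      (forall f, f \in g -> J f) -> forall a, lead_ideal I n a -> lead_ideal J n a.
  move=> n; have [sn [snI Isn]] := hR _ (lead_ideal_is_ideal n hI).
  have [g [gsn sng]] := ex_seq_lift snI.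
  exists g; split=> [f /gsn [x _ []] //|J hJ Jg a Ia].
  apply: (Isn a Ia _ (lead_ideal_is_ideal n hJ)) => x /sng [f fg [If sf fx]].
  by exists f; split=> //; apply: Jg.
exists (flatten [seq g n | n <- iota 0 N.+1]); split.
  move=> f /flattenP [_ /mapP [n _ ->] fg]; exact: (hg n).1.
(* Intersecting with [I] keeps the remainder [q - h] in [I], so that cancelling leading terms can be
   repeated. *)
move=> q Iq J0 hJ0 J0g; pose J f := I f /\ J0 f.
have hJ : is_ideal J.
  have [J00 J0D J0M] := hJ0; split=> [//|x y [? ?] [? ?]|r x [? ?]].
    by split; [apply: ID|apply: J0D].
  by split; [apply: IM|apply: J0M].
have Jg n f : (n <= N)%N -> f \in g n -> J f.
  move=> nN fg; split; first exact: (hg n).1.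
  by apply: J0g; apply/flattenP; exists (g n) => //; apply/mapP; exists n; rewrite // mem_iota.
suff: J q by case.
have [m] := ubnP (size q); elim: m q Iq => // m IH q Iq; rewrite ltnS => qm.
have [->|q0] := eqVneq q 0; first by case: hJ.
set n := (size q).-1.
have sq : size q = n.+1 by rewrite prednK ?size_poly_gt0.
have [h [Jh sh hn]] : lead_ideal J n q`_n.
  have qL : lead_ideal I n q`_n by exists q; rewrite sq.
  have [nN|Nn] := leqP n N.
    by apply: (hg n).2 => // f; apply: Jg.
  apply: (lead_ideal_leq hJ (ltnW Nn)); apply: (hg N).2 => // [f|]; first exact: Jg.
  by apply: Ls (lead_ideal_is_ideal N hI) sN; exists n.
have JqB : J (q - h).
  apply: IH.
    by apply: ID => //; rewrite -mulN1r; apply: IM; case: Jh.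
  have le : (size (q - h)%R <= n.+1)%N.
    by apply: leq_trans (size_polyD _ _) _; rewrite size_polyN geq_max sq leqnn.
  apply: leq_trans qm; rewrite sq ltnS; apply/leq_sizeP => j nj.
  move: nj; rewrite leq_eqVlt => /predU1P [<-|nj].
    by rewrite coefB hn -/n subrr.
  by rewrite nth_default // (leq_trans le).
have [_ JD _] := hJ; have := JD _ _ JqB Jh; by rewrite subrK.
Qed.

(** [P] need not be an ideal. The ideal it generates is the union of the spans of finite parts of
    [P], so generators can be traded for elements of [P]. *)
Lemma noetherian_subset (R : comNzRingType) (P : R -> Prop) : noetherian R ->
  exists s : seq R, (forall x, x \in s -> P x) /\ forall x, P x -> in_span s x.
Proof.
move=> hR; pose I x := exists s : seq R, (forall y, y \in s -> P y) /\ in_span s x.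
have hI : is_ideal I.
  split.
  - by exists [::]; split=> // J [].
  - move=> x y [s [sP sx]] [r [rP ry]]; exists (s ++ r); split.
      by move=> z; rewrite mem_cat => /orP [/sP|/rP].
    move=> J hJ Jsr; have [_ JD _] := hJ; apply: JD.
      by apply: sx => // z zs; apply: Jsr; rewrite mem_cat zs.
    by apply: ry => // z zs; apply: Jsr; rewrite mem_cat zs orbT.
  - move=> r x [s [sP sx]]; exists s; split=> // J hJ Js; have [_ _ JM] := hJ.
    by apply: JM; apply: sx.
have [s [sI Is]] := hR _ hI.
have [ss [hss sss]] := @ex_seq_lift R (seq R) (fun x r => (forall y, y \in r -> P y) /\ in_span r x) s sI.
exists (flatten ss); split.
  by move=> x /flattenP [r /hss [y _ [rP _]]]; apply: rP.
move=> x Px J hJ Jss.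
have Ix : I x by exists [:: x]; split=> [y|J' _]; [rewrite inE => /eqP ->|apply; rewrite mem_head].
apply: (Is x Ix J hJ) => y /sss [r rss [_ ry]]; apply: ry => // z zr.
by apply: Jss; apply/flattenP; exists r.
Qed.

(** [A] is the polynomial ring in [N] variables, built as an iterated [{poly _}] so that the
    one-variable theorem applies; only constants, variables and evaluations are remembered. *)
Lemma noetherian_tower (K : fieldType) N :
  exists (A : comNzRingType) (c : {rmorphism K -> A}) (v : 'I_N -> A), noetherian A /\
    forall x : 'I_N -> K, exists e : {rmorphism A -> K},
      (forall a, e (c a) = a) /\ forall i, e (v i) = x i.
Proof.
elim: N => [|N [A [c [v [hA hx]]]]].
  exists K, (idfun : {rmorphism K -> K}), (fun=> 0); split; first exact: noetherian_field.
  by move=> x; exists (idfun : {rmorphism K -> K}); split=> // -[].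
exists {poly A}, (polyC \o c : {rmorphism K -> {poly A}}),
  (fun i => if unlift ord0 i is Some j then (v j)%:P else 'X).
split=> [|x]; first exact: noetherian_poly.
have [e [ec ev]] := hx (fun j => x (lift ord0 j)).
exists (horner_morph (fun y => mulrC (x ord0) (e y)) : {rmorphism {poly A} -> K}).
split=> [a|i] /=; first by rewrite horner_morphC ec.
by case: unliftP => [j|] ->; rewrite ?horner_morphC ?horner_morphX ?ev.
Qed.

(** The elements of [A] vanishing at a given point form an ideal, so vanishing of generators chosen
    in the image of [P] spreads to all of [P]. *)
Lemma finite_equations (K : fieldType) N (P : {mpoly K[N]} -> Prop) :
  exists s : seq {mpoly K[N]}, (forall q, q \in s -> P q) /\
    forall x : 'I_N -> K, (forall q, q \in s -> q.@[x] = 0) ->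
      forall q, P q -> q.@[x] = 0.
Proof.
have [A [c [v [hA hx]]]] := noetherian_tower K N.
pose theta (q : {mpoly K[N]}) := \sum_(m <- msupp q) c q@_m * \prod_i v i ^+ m i.
have [s [sP Ps]] := noetherian_subset (fun a => exists q, P q /\ theta q = a) hA.
have [r [rs sr]] := ex_seq_lift sP; exists r; split; first by move=> q /rs [a _ []].
move=> x rx q Pq; have [e [ec ev]] := hx x.
have eE q' : e (theta q') = q'.@[x].
  rewrite mevalE rmorph_sum; apply: eq_bigr => m _.
  rewrite rmorphM ec rmorph_prod; congr (_ * _); apply: eq_bigr => i _.
  by rewrite rmorphXn ev.
rewrite -eE; apply: (Ps (theta q) _ (fun a => e a = 0)); first by exists q.
  split=> [|a b ea eb|a b eb]; first exact: rmorph0.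
    by rewrite rmorphD ea eb addr0.
  by rewrite rmorphM eb mulr0.
by move=> a /sr [q' q'r [_ <-]]; rewrite eE; apply: rx.
Qed.

End Noetherian.

(** * Cuttings for zero sets *)

Section ZeroSets.

Import GRing.Theory.
Local Open Scope ring_scope.

(* Collecting the monomials in the first [n] variables makes a polynomial
   equation linear in suitable coordinates. *)
Lemma cuttable_equation (K : fieldType) n m (q : {mpoly K[n + m]}) :
  lin_cuttable K ->
  cuttable (fun (x : 'rV[K]_n) (y : 'rV[K]_m) => q.@[fun i => row_mx x y 0 i] = 0).
Proof.
move=> hK; apply: cuttable_pull (hK (size (msupp q))).
pose mon j : 'X_{1.. n + m} := nth 0%MM (msupp q) j.
exists (fun x => \col_j \prod_i x 0 i ^+ mon j (lshift m i)).
exists (fun y => \row_j (q@_(mon j) * \prod_i y 0 i ^+ mon j (rshift n i))) => x y.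
set A := \row_j _; set B := \col_j _.
have -> : q.@[fun i => row_mx x y 0 i] = (A *m B) 0 0.
  rewrite mevalE (big_nth 0%MM) big_mkord mxE; apply: eq_bigr => j _.
  rewrite !mxE -mulrA; congr (_ * _); rewrite big_split_ord mulrC /=.
  by congr (_ * _); apply: eq_bigr => i _; rewrite ?row_mxEl ?row_mxEr.
rewrite /lin_inc; split=> [h|->]; last by rewrite mxE.
by apply/matrixP => i j; rewrite !ord1 h mxE.
Qed.

Lemma zero_set_cuttable (K : fieldType) n m (P : {mpoly K[n + m]} -> Prop) :
  lin_cuttable K -> cuttable (zero_set P).
Proof.
move=> hK; have [s [sP Ps]] := finite_equations P.
apply: cuttable_pull (cuttable_all s (fun q => cuttable_equation q hK)).
by exists id, id => x y; split=> [h q /sP|h]; [apply: h|apply: Ps].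
Qed.

End ZeroSets.

(** * Kővári-Sós-Turán counting in one cell *)

Section Counting.

Lemma ffact_leq_expn n d : n ^_ d <= n ^ d.
Proof.
by elim: d => // d IH; rewrite ffactnSr expnSr; apply: leq_mul; rewrite ?leq_subr.
Qed.

(** Factor by factor: n <= d (n - i) whenever i < d <= n. *)
Lemma expn_leq_ffact n d : d <= n -> n ^ d <= d ^ d * n ^_ d.
Proof.
move=> dn; rewrite ffact_prod.
have prod_const x : \prod_(i < d) x = x ^ d by rewrite prod_nat_const card_ord.
rewrite -!prod_const -big_split /=; apply: leq_prod => i _.
by have := ltn_ord i; nia.
Qed.

Variables (S T : finType) (e : S -> T -> bool) (d s : nat).

Definition nbh (V : {set S}) (b : T) : {set S} := [set a in V | e a b].

Hypothesis e_free : forall (D : {set S}) (F : {set T}),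
  (forall a b, a \in D -> b \in F -> e a b) -> #|D| < d \/ #|F| < s.

(* Count pairs of a vertex [b] and an injective [d]-tuple of neighbours. *)
Lemma kst_count (V : {set S}) : \sum_b #|nbh V b| ^_ d <= s * #|V| ^_ d.
Proof.
have ffactE (W : {set S}) : #|W| ^_ d =
    \sum_(f : {ffun 'I_d -> S}) ((f \in ffun_on W) && injectiveb f).
  rewrite -[d in LHS]card_ord -card_inj_ffuns_on -sum1dep_card big_mkcond.
  by apply: eq_bigr => f _; case: ifP.
under eq_bigr do rewrite ffactE.
rewrite exchange_big ffactE big_distrr /=; apply: leq_sum => f _.
have [/andP [/ffun_onP fV /injectiveP finj]|nf] := boolP (_ && _); last first.
  rewrite muln0 big1 // => b _; apply/eqP; rewrite eqb0.
  apply: contra nf => /andP [/ffun_onP fb ->]; rewrite andbT.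
  by apply/ffun_onP => i; have := fb i; rewrite inE => /andP [].
(* The values of an injective tuple form a set of size [d], so freeness leaves fewer than [s] common
   neighbours. *)
rewrite muln1; pose F := [set b | f \in ffun_on (nbh V b)].
have [||] := @e_free [set f i | i : 'I_d] F.
- by move=> _ b /imsetP [i _ ->]; rewrite inE => /ffun_onP /(_ i); rewrite inE => /andP [].
- by rewrite card_imset // card_ord ltnn.
move=> /ltnW; apply: leq_trans; rewrite -sum1dep_card [X in _ <= X]big_mkcond.
by apply: leq_sum => b _; case: (f \in _) => //=; apply: leq_b1.
Qed.

Definition split_by (V : {set S}) : {set T} :=
  [set b | [exists a in V, e a b] && [exists a in V, ~~ e a b]].

(** The vertices [b] fall into four classes, one per term: fewer than [d] neighbours; joined to all
    of [V], which happens for at most [s] of them once [d <= #|V|]; splitting [V] with at most [tau]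
    neighbours; more than [tau] neighbours. In the last class n (tau+1)^(d-1) <= n^d, and
    [kst_count] bounds the sum of these powers. *)
Lemma cell_count (V : {set S}) (tau : nat) : 0 < d -> exists H,
  \sum_b #|nbh V b| <= d * #|T| + s * #|V| + #|split_by V| * tau + H /\
  H * tau.+1 ^ d.-1 <= d ^ d * s * #|V| ^ d.
Proof.
move=> d0; pose n b := #|nbh V b|.
exists (\sum_(b | (tau < n b) && (d <= n b)) n b); split.
  pose full b := (d <= #|V|) && (V \subset nbh V b).
  have full_le : \sum_b full b <= s.
    have [dV|Vd] := leqP d #|V|; last by rewrite big1 // => b _; rewrite /full leqNgt Vd.
    have [||] := @e_free V [set b | full b].
    - by move=> a b aV; rewrite inE => /andP [_ /subsetP /(_ a aV)]; rewrite inE => /andP [].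
    - by rewrite ltnNge dV.
    move=> /ltnW; apply: leq_trans; rewrite -sum1dep_card [X in _ <= X]big_mkcond.
    by apply: leq_sum => b _; case: (full b).
  apply: leq_trans (_ : \sum_b (d + full b * #|V| + (b \in split_by V) * tau
      + ((tau < n b) && (d <= n b)) * n b) <= _); last first.
    have -> : #|split_by V| = \sum_b (b \in split_by V).
      by rewrite -sum1_card big_mkcond; apply: eq_bigr => b _; case: (_ \in _).
    rewrite !big_split /=; apply: leq_add; [apply: leq_add; [apply: leq_add|]|].
    - by rewrite sum_nat_const mulnC.
    - by rewrite -big_distrl leq_mul2r full_le orbT.
    - by rewrite -big_distrl.
    - rewrite [X in _ <= X]big_mkcond; apply: leq_sum => b _.
      by case: ifP; rewrite ?mul1n.
  apply: leq_sum => b _; rewrite -/(n b).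
  have [dn|] := leqP d (n b); last by lia.
  have [Vb|/subsetPn [a' a'V na']] := boolP (V \subset nbh V b).
    have nV : n b <= #|V| by apply: subset_leq_card; apply/subsetP => a; rewrite inE => /andP [].
    by rewrite /full Vb (leq_trans dn nV); lia.
  have [tn|] := ltnP tau (n b); first by lia.
  suff -> : b \in split_by V by lia.
  rewrite inE; apply/andP; split; last first.
    by apply/existsP; exists a'; move: na'; rewrite inE a'V.
  have /card_gt0P [a] : 0 < #|nbh V b| by apply: leq_trans d0 dn.
  by rewrite inE => ?; apply/existsP; exists a.
apply: leq_trans (_ : \sum_b d ^ d * n b ^_ d <= _); last first.
  rewrite -big_distrr -mulnA leq_mul2l /=; apply/orP; right.
  by apply: leq_trans (kst_count V) _; rewrite leq_mul2l ffact_leq_expn orbT.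
rewrite big_distrl [X in X <= _]big_mkcond /=; apply: leq_sum => b _.
case: ifP => // /andP [tn dn]; apply: leq_trans (expn_leq_ffact dn).
case: (d) d0 => // d' _ /=; rewrite expnS leq_mul2l; apply/orP; right.
by case: d' => // d'; rewrite leq_exp2r.
Qed.

End Counting.

(** * Incidences distributed over the cells *)

Section IncidenceCells.

Variables (K : fieldType) (n m : nat) (E : 'rV[K]_n -> 'rV[K]_m -> Prop).

Lemma incidences_leq (A : {fset 'rV[K]_n}) (B : {fset 'rV[K]_m}) :
  incidences E A B <=
  #|[set ab : A * B | pbool (E (val ab.1) (val ab.2))]|.
Proof.
set W := [set ab | _].
apply: (@leq_trans #|` [fset (val ab.1, val ab.2) | ab in W]%fset|); last first.
  by apply: leq_trans (leq_imfset_card _ _ _) _; rewrite /= -cardE.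
apply: fsubset_leq_card; apply/fsubsetP => -[a b]; rewrite !inE /= => /andP [/andP [aA bB] Eab].
by apply/imfsetP; exists ([` aA], [` bB])%fset; rewrite //= inE.
Qed.

Lemma Kds_free_set d s (A : {fset 'rV[K]_n}) (B : {fset 'rV[K]_m})
    (D : {set A}) (F : {set B}) : Kds_free E d s ->
  (forall a b, a \in D -> b \in F -> pbool (E (val a) (val b))) ->
  #|D| < d \/ #|F| < s.
Proof.
move=> hE h; have card_val (U : choiceType) (C : {fset U}) (G : {set C}) :
    #|` [fset val x | x in G]%fset| = #|G| by rewrite card_imfset //= -?cardE //; apply: val_inj.
have := hE [fset val x | x in D]%fset [fset val x | x in F]%fset.
rewrite !card_val; apply => _ _ /imfsetP [a aD ->] /imfsetP [b bF ->].
exact/pboolP/h.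
Qed.

(** A range that splits the points of [A] in a cell crosses this cell, so the cutting bounds
    [x p]. *)
Lemma incidences_cells d s T a r : 0 < d -> Kds_free E d s -> cutting E T a r ->
  forall (A : {fset 'rV[K]_n}) (B : {fset 'rV[K]_m}),
  exists I v x : nat -> nat,
    [/\ incidences E A B <= \sum_(p < T) I p, \sum_(p < T) v p = #|` A|%fset &
     forall p, r * x p <= a * #|` B|%fset /\ forall tau, exists H,
       I p <= d * #|` B|%fset + s * v p + x p * tau + H /\
       H * tau.+1 ^ d.-1 <= d ^ d * s * v p ^ d].
Proof.
move=> d0 hE cutE A B; have [c [cT hc]] := cutE (enum_fset B).
pose e (a : A) (b : B) := pbool (E (val a) (val b)).
pose V p : {set A} := [set a | c (val a) == p].
exists (fun p => \sum_b #|nbh e (V p) b|), (fun p => #|V p|), (fun p => #|split_by e (V p)|).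
split=> [||p].
- apply: leq_trans (incidences_leq A B) _.
  rewrite exchange_big /= -sum1dep_card big_mkcond /=.
  rewrite -(pair_bigA _ (fun a b => if e a b then 1 else 0)) exchange_big /=.
  apply: leq_sum => b _.
  rewrite (partition_big (fun a : A => Ordinal (cT (val a))) predT) //=.
  apply: leq_sum => p _; rewrite -sum1dep_card -big_mkcondr /=.
  by rewrite [X in X <= _]big_mkcond [X in _ <= X]big_mkcond /=; apply: leq_sum => a' _; rewrite inE -val_eqE.
- rewrite cardfE -[in RHS]sum1_card (partition_big (fun a : A => Ordinal (cT (val a))) predT) //=.
  by apply: eq_bigr => p _; rewrite -sum1dep_card; apply: eq_bigl => a'; rewrite -val_eqE.
- split; last first.
    move=> tau; rewrite cardfE; apply: cell_count => // D F.
    exact: Kds_free_set.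
  apply: leq_trans (hc p); rewrite leq_mul2l; apply/orP; right.
  rewrite /crossings enum_fsetE count_map enumT cardE /enum_mem size_filter.
  apply: sub_count => b bX; have {bX} : b \in split_by e (V p) := bX.
  rewrite inE => /andP [/existsP [u /andP [uV ub]] /existsP [w /andP [wV wb]]].
  move: uV wV ub wb; rewrite !inE => /eqP cu /eqP cw /pboolP Eu /pboolP Ew.
  by apply/pboolP; exists (val u), (val w).
Qed.

End IncidenceCells.

(* Restores the Stdlib [field] tactic, shadowed by the MathComp one. *)
From Stdlib Require Import Field.

(** * Real estimates and choice of parameters *)

Section RealEstimates.

Local Open Scope R_scope.

Lemma INR_leq (a b : nat) : (a <= b)%N -> INR a <= INR b.
Proof. by move/leP; apply: le_INR. Qed.

Lemma INR_addn (a b : nat) : INR (a + b)%N = INR a + INR b.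
Proof. exact: plus_INR. Qed.

Lemma INR_muln (a b : nat) : INR (a * b)%N = INR a * INR b.
Proof. exact: mult_INR. Qed.

Lemma INR_expn (a n : nat) : INR (expn a n) = INR a ^ n.
Proof. by elim: n => // n IH; rewrite expnS INR_muln IH. Qed.

Lemma nat_floor (x : R) : 0 <= x -> exists n : nat, INR n <= x < INR n + 1.
Proof.
move=> x0; have [h1 h2] := archimed x.
have up0 : Z.le Z0 (Z.sub (up x) (Zpos xH)).
  by have : Z.lt Z0 (up x) by [apply: lt_IZR; lra]; lia.
exists (Z.to_nat (Z.sub (up x) (Zpos xH))); rewrite INR_IZR_INZ Z2Nat.id // minus_IZR; lra.
Qed.

Lemma INR_sum_leq (T : nat) (I v : nat -> nat) (u w : R) :
  (forall p, INR (I p) <= u + w * INR (v p)) ->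
  INR (\sum_(p < T) I p) <= INR T * u + w * INR (\sum_(p < T) v p).
Proof.
move=> h; elim: T => [|T IH].
  by rewrite !big_ord0 /=; lra.
rewrite S_INR !big_ord_recr /= !INR_addn.
move: IH (h T); move: (INR (\sum_(p < T) I p)) (INR (\sum_(p < T) v p)) => a b ? ?; lra.
Qed.

(** The threshold [tau] is the integer part of [mu * v], proportional to the size of the cell. The
    bound is then affine in [v] with coefficients common to all cells, and can be summed over
    them. *)
Lemma cell_real_bound (d s b I v x : nat) (X mu : R) :
  (0 < d)%N -> 0 < mu -> INR x <= X ->
  (forall tau, exists H, (I <= d * b + s * v + x * tau + H)%N /\
     (H * tau.+1 ^ d.-1 <= d ^ d * s * v ^ d)%N) ->
  INR I <= INR d * INR b +
    (INR s + X * mu + INR d ^ d * INR s / mu ^ d.-1) * INR v.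
Proof.
move=> d0 mu0 xX h; have v0 := pos_INR v.
have [tau [tau1 tau2]] : exists n : nat, INR n <= mu * INR v < INR n + 1.
  by apply: nat_floor; nra.
have [H [/INR_leq hI /INR_leq hH]] := h tau.
move: hI hH; rewrite !INR_addn !INR_muln !INR_expn S_INR => hI hH.
have xt : INR x * INR tau <= X * (mu * INR v).
  by apply: Rmult_le_compat => //; apply: pos_INR.
have H0 := pos_INR H.
suff : INR H <= INR d ^ d * INR s / mu ^ d.-1 * INR v by lra.
have mup : 0 < mu ^ d.-1 by apply: pow_lt.
have [v00|vpos] : INR v = 0 \/ 0 < INR v by lra.
  move: hH; rewrite v00 pow_i; last exact/ltP.
  have : 0 < (INR tau + 1) ^ d.-1 by apply: pow_lt; have := pos_INR tau; lra.
  by move=> ? ?; nra.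
apply: (Rmult_le_reg_r (mu ^ d.-1 * INR v ^ d.-1)).
  by apply: Rmult_lt_0_compat => //; apply: pow_lt.
rewrite -Rpow_mult_distr.
apply: Rle_trans (_ : INR H * (INR tau + 1) ^ d.-1 <= _).
  by apply: Rmult_le_compat_l => //; apply: pow_incr; nra.
apply: Rle_trans hH _; apply: Req_le.
have -> : INR v ^ d = INR v * INR v ^ d.-1 by rewrite -{1}(prednK d0).
rewrite Rpow_mult_distr; move: (mu ^ d.-1) (INR v ^ d.-1) (INR d ^ d) mup => M V D M0.
field; lra.
Qed.

(** Here [al] and [be] are the logarithms of the two sizes. The best [j] is the largest one keeping
    the term with T^j below the mixed term, that is [j * q <= x]; rounding costs the factor
    [exp (L * delta)]. The excess eps be/d fits into eps delta be because 1/d <= delta, which is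
    where [2 <= d] enters. *)
Lemma log_estimate (T d s c : R) : 1 <= T -> 2 <= d -> 0 <= s -> 0 <= c ->
  exists eps C, 0 < eps /\ 0 < C /\ forall al be I : R, 0 <= al -> 0 <= be ->
    (forall j, I <= d * exp (INR j * ln T + be) + s * exp al +
       (1 + c) * exp ((be - INR j * ln 2) * ((d - 1) / d) + al)) ->
    I <= C * (exp ((1 - eps) * al) * exp (((d - 1) / d * (1 + eps)) * be)
           + exp al + exp be).
Proof.
move=> T1 d2 s0 c0; set delta := (d - 1) / d; set L := ln 2.
have L0 : 0 < L by rewrite /L -ln_1; apply: ln_increasing; lra.
have t0 : 0 <= ln T.
  by have [->|T1'] := Req_dec T 1; [rewrite ln_1; lra|rewrite -ln_1; left; apply: ln_increasing; lra].
have invd : 0 < / d by apply: Rinv_0_lt_compat; lra.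
have deltaE : delta = 1 - / d by rewrite /delta; field; lra.
have invd2 : / d <= / 2 by apply: Rinv_le_contravar; lra.
have delta0 : 0 < delta by lra.
have delta1 : / d <= delta by lra.
set q := ln T + L * delta.
have Ld : 0 < L * delta by apply: Rmult_lt_0_compat.
have q0 : 0 < q by rewrite /q; lra.
pose eps := L * delta / q.
have eps0 : 0 < eps by apply: Rdiv_lt_0_compat.
pose C := (1 + c + d + s) * exp (L * delta).
have expL : 1 <= exp (L * delta) by have := exp_ineq1_le (L * delta); lra.
have C1 : 1 + c + d + s <= C by rewrite /C; nra.
exists eps, C; split=> //; split; first lra.
move=> al be I al0 be0 h.
have exp_le x y : x <= y -> exp x <= exp y.
  by case=> [/exp_increasing|->]; lra.
have ea := exp_pos al; have eb := exp_pos be.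
have em : 0 < exp ((1 - eps) * al) * exp (delta * (1 + eps) * be).
  by apply: Rmult_lt_0_compat; apply: exp_pos.
pose x := al - be * / d.
have [x0|x0] := Rlt_le_dec x 0.
  (* Here al < be/d, and without any cutting the mixed term is already at most [exp be]. *)
  have := h 0%N; rewrite /= !Rmult_0_l Rplus_0_l Rminus_0_r => hI.
  have : exp (be * delta + al) <= exp be by apply: exp_le; rewrite deltaE; rewrite /x in x0; lra.
  by nra.
have [j [j1 j2]] : exists n : nat, INR n <= x / q < INR n + 1.
  by apply: nat_floor; apply: Rmult_le_pos => //; left; apply: Rinv_0_lt_compat.
have jq : INR j * q <= x.
  by have := Rmult_le_compat_r q _ _ (Rlt_le _ _ q0) j1; rewrite /Rdiv Rmult_assoc Rinv_l; lra.
have hI := h j; set M := exp ((be - INR j * L) * delta + al) in hI.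
have le1 : exp (INR j * ln T + be) <= M.
  by apply: exp_le; rewrite deltaE; move: jq; rewrite /q /x deltaE; lra.
have le2 : M <= exp (L * delta) * (exp ((1 - eps) * al) * exp (delta * (1 + eps) * be)).
  rewrite -!exp_plus; apply: exp_le.
  have : eps * x <= (INR j + 1) * (L * delta).
    have -> : eps * x = x / q * (L * delta) by rewrite /eps; field; lra.
    by apply: Rmult_le_compat_r; lra.
  have : eps * (be * / d) <= eps * (be * delta).
    by apply: Rmult_le_compat_l; [lra|apply: Rmult_le_compat_l].
  by rewrite /x; lra.
have M0 : 0 < M := exp_pos _.
have : I <= s * exp al + (1 + c + d) * M by nra.
have : (1 + c + d) * M <= C * (exp ((1 - eps) * al) * exp (delta * (1 + eps) * be)).
  apply: Rle_trans (_ : (1 + c + d) * (exp (L * delta) * (exp ((1 - eps) * al) * exp (delta * (1 + eps) * be))) <= _).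
    by apply: Rmult_le_compat_l; lra.
  rewrite -Rmult_assoc; apply: Rmult_le_compat_r; first lra.
  by rewrite /C; apply: Rmult_le_compat_r; lra.
have : s * exp al <= C * exp al by apply: Rmult_le_compat_r; lra.
have : 0 < C * exp be by apply: Rmult_lt_0_compat; lra.
lra.
Qed.

End RealEstimates.

(** * Incidence bound for relations with cuttings *)

Section IncidenceBound.

Local Open Scope R_scope.

Lemma exp_mul_INR (n : nat) (x : R) : exp (INR n * x) = exp x ^ n.
Proof.
elim: n => [|n IH]; first by rewrite Rmult_0_l exp_0.
by rewrite S_INR Rmult_plus_distr_r Rmult_1_l exp_plus IH Rmult_comm.
Qed.

Lemma npow_ge0 (a : nat) (x : R) : 0 <= npow a x.
Proof. by rewrite /npow; case: eqP => _; [lra|left; apply: exp_pos]. Qed.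

Variables (K : fieldType) (n m : nat) (E : 'rV[K]_n -> 'rV[K]_m -> Prop).
Variables (d s T : nat).
Hypotheses (free : Kds_free E d s) (cut : cutting E T 1 2).

Lemma incidence_bound_cells (j : nat) (mu : R)
    (A : {fset 'rV[K]_n}) (B : {fset 'rV[K]_m}) :
  (0 < d)%N -> 0 < mu ->
  INR (incidences E A B) <=
    INR T ^ j * (INR d * INR #|` B|%fset) +
    (INR s + INR #|` B|%fset / 2 ^ j * mu + INR d ^ d * INR s / mu ^ d.-1) *
      INR #|` A|%fset.
Proof.
move=> d0 mu0.
have [I [v [x [hI <- hp]]]] := incidences_cells d0 free (cutting_exp j cut) A B.
apply: Rle_trans (INR_leq hI) _; rewrite -INR_expn.
apply: INR_sum_leq => p; have [hx htau] := hp p.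
apply: cell_real_bound htau => //.
have two_j : 0 < 2 ^ j by apply: pow_lt; lra.
apply: (Rmult_le_reg_l (2 ^ j)) => //.
have -> : 2 ^ j * (INR #|` B|%fset / 2 ^ j) = INR #|` B|%fset by field; lra.
by move/INR_leq: hx; rewrite exp1n mul1n INR_muln INR_expn.
Qed.

Theorem cuttable_incidences :
  exists eps C : R, 0 < eps /\ 0 < C /\
    forall (A : {fset 'rV[K]_n}) (B : {fset 'rV[K]_m}),
      INR (incidences E A B) <=
       C * (npow #|` A|%fset (1 - eps) *
            npow #|` B|%fset ((INR d - 1) / INR d * (1 + eps))
            + INR #|` A|%fset + INR #|` B|%fset).
Proof.
have bound0 eps (A : {fset 'rV[K]_n}) (B : {fset 'rV[K]_m}) : 0 <= npow #|` A|%fset (1 - eps) *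
    npow #|` B|%fset ((INR d - 1) / INR d * (1 + eps)).
  by apply: Rmult_le_pos; apply: npow_ge0.
have s0 := pos_INR s.
have [d0|d1] := posnP d.
  (* For [d = 0], freeness applied to the empty set of points gives |B| < s. *)
  exists 1, (INR s + 1); split; [lra|split; [lra|]] => A B.
  have a0 := pos_INR #|` A|%fset; have b0 := pos_INR #|` B|%fset.
  have /INR_leq : (incidences E A B <= s * #|` A|%fset)%N.
    apply: leq_trans (incidences_leq E A B) _; apply: leq_trans (max_card _) _.
    rewrite card_prod mulnC -!cardfE leq_mul2r; apply/orP; right.
    have [//||/ltnW //] := free (A := fset0) (B := B); last by rewrite d0.
  by rewrite INR_muln; have := bound0 1 A B; nra.
have [d_eq1|d2] : d = 1%N \/ (2 <= d)%N by lia.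
  (* For [d = 1] a linear bound holds with a single cell: this [mu] makes |B| mu at most 1, and the
     term with [mu ^ d.-1] no longer depends on [mu]. *)
  exists 1, (2 * INR s + 2); split; [lra|split; [lra|]] => A B.
  have a0 := pos_INR #|` A|%fset; have b0 := pos_INR #|` B|%fset.
  have := bound0 1 A B; have mu0 : 0 < / (INR #|` B|%fset + 1).
    by apply: Rinv_0_lt_compat; lra.
  have := incidence_bound_cells 0 A B d1 mu0.
  rewrite d_eq1 /= !Rmult_1_l !Rdiv_1_r ?Rmult_1_r ?Rmult_1_l.
  have : INR #|` B|%fset * / (INR #|` B|%fset + 1) <= 1.
    apply: (Rmult_le_reg_r (INR #|` B|%fset + 1)); first lra.
    by rewrite Rmult_assoc Rinv_l; lra.
  move: (INR #|` B|%fset * _) (npow _ _ * npow _ _) => z N le1 hI N0.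
  move: (INR #|` A|%fset) (INR #|` B|%fset) (INR s) a0 b0 s0 hI => a b s' a0 b0 s0 hI.
  nra.
have T1 : 1 <= INR T.
  have [c [cT _]] := cut [::]; rewrite -[1]/(INR 1); apply: INR_leq.
  by have := cT 0%R; lia.
have d2R : 2 <= INR d by rewrite -[2]/(INR 2); apply: INR_leq.
pose c := INR d ^ d * INR s.
have c0 : 0 <= c by apply: Rmult_le_pos => //; apply: pow_le; lra.
have [eps [C [eps0 [C0 hC]]]] := log_estimate T1 d2R s0 c0.
pose C' := C + INR s + INR d + c.
exists eps, C'; split=> //; split; first by rewrite /C'; lra.
move=> A B; have N0 := bound0 eps A B.
have a0 := pos_INR #|` A|%fset; have b0 := pos_INR #|` B|%fset.
have trivial_bound (a b N I : R) : 0 <= a -> 0 <= b -> 0 <= N ->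
    I <= INR d * b + (INR s + c) * a -> I <= C' * (N + a + b).
  move=> a0' b0' N0' hI; rewrite /C'.
  have := Rmult_le_pos _ _ s0 b0'; have := Rmult_le_pos _ _ c0 b0'.
  have := Rmult_le_pos _ _ s0 N0'; have := Rmult_le_pos _ _ c0 N0'.
  have d0 : 0 <= INR d by lra.
  have := Rmult_le_pos _ _ d0 a0'; have := Rmult_le_pos _ _ d0 N0'.
  have C00 : 0 <= C by lra.
  have := Rmult_le_pos _ _ C00 a0'; have := Rmult_le_pos _ _ C00 b0'.
  have := Rmult_le_pos _ _ C00 N0'; move=> *; lra.
(* An empty set has no logarithm; one cell with [mu = 1] then gives a linear bound. *)
have [A0|A1] := posnP #|` A|%fset.
  apply: trivial_bound => //; apply: Rle_trans (incidence_bound_cells 0 A B d1 Rlt_0_1) _.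
  by rewrite A0 /= !Rmult_0_r !Rmult_1_l; lra.
have [B0|B1] := posnP #|` B|%fset.
  apply: trivial_bound => //; apply: Rle_trans (incidence_bound_cells 0 A B d1 Rlt_0_1) _.
  by rewrite B0 /= pow1 -/c /Rdiv !Rmult_0_l Rinv_1 !Rmult_1_r Rmult_0_r; lra.
have A1R : 1 <= INR #|` A|%fset by rewrite -[1]/(INR 1); apply: INR_leq.
have B1R : 1 <= INR #|` B|%fset by rewrite -[1]/(INR 1); apply: INR_leq.
have ln_ge0 z : 1 <= z -> 0 <= ln z.
  by case=> [z1|<-]; [rewrite -ln_1; left; apply: ln_increasing; lra|rewrite ln_1; lra].
have expA : exp (ln (INR #|` A|%fset)) = INR #|` A|%fset by apply: exp_ln; lra.
have expB : exp (ln (INR #|` B|%fset)) = INR #|` B|%fset by apply: exp_ln; lra.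
have := hC _ _ (INR (incidences E A B)) (ln_ge0 _ A1R) (ln_ge0 _ B1R).
rewrite expA expB /npow (gtn_eqF A1) (gtn_eqF B1) /Rpower => h.
apply: Rle_trans (h _) _; last first.
  apply: Rmult_le_compat_r; last by rewrite /C'; lra.
  by move: N0; rewrite /npow (gtn_eqF A1) (gtn_eqF B1) /Rpower; lra.
move=> j; pose w := ln (INR #|` B|%fset) - INR j * ln 2.
have wE : INR #|` B|%fset / 2 ^ j = exp w.
  rewrite /w /Rminus exp_plus expB Ropp_mult_distr_r exp_mul_INR exp_Ropp exp_ln; last lra.
  by rewrite pow_inv.
(* This [mu] balances the last two terms of [incidence_bound_cells]. *)
have := incidence_bound_cells j A B d1 (exp_pos (- (w / INR d))).
rewrite wE -exp_mul_INR -/c.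
have -> : INR d.-1 = INR d - 1 by rewrite -{2}(prednK d1) S_INR; lra.
have -> : (INR d - 1) * - (w / INR d) = - (w * ((INR d - 1) / INR d)) by field; lra.
set z := w * ((INR d - 1) / INR d).
have -> : c / exp (- z) = c * exp z by rewrite exp_Ropp /Rdiv Rinv_inv.
have -> : exp w * exp (- (w / INR d)) = exp z.
  by rewrite -exp_plus; congr exp; rewrite /z; field; lra.
rewrite !exp_plus -/w -/z expA expB exp_mul_INR exp_ln; last lra.
by move=> hI; apply: Rle_trans hI _; lra.
Qed.

End IncidenceBound.

From Stdlib Require Import Reals.

Theorem theorem1p1 (p : nat) (K : fieldType) (n m : nat)
  (P : {mpoly K[n + m]} -> Prop) (d s : nat) :
  prime p -> fg_ext_of_Fp p K ->
  Kds_free (zero_set P) d s ->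
  exists eps C : R, (0 < eps)%R /\ (0 < C)%R /\
    forall (A : {fset 'rV[K]_n}) (B : {fset 'rV[K]_m}),
      (INR (incidences (zero_set P) A B) <=
       C * (npow #|` A| (1 - eps) *
            npow #|` B| ((INR d - 1) / INR d * (1 + eps))
            + INR #|` A| + INR #|` B|))%R.
Proof.
move=> p_pr hK free.
(* A single cutting at proportion 1/2 is requested; its iterates provide T^j cells at proportion
   2^(-j). *)
have [T cut] := zero_set_cuttable P (lin_cuttable_fg p_pr hK) 2.
exact: cuttable_incidences free cut.
Qed.
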